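(* Let $X$ be a diffusion on $[0,\infty)$ on natural scale with speed measure $m$, absorbed at $0$, which comes down from infinity and hits $0$ in a.s. finite time. Assume there exist constants $C>0$ and $\rho>0$ such that $$I(x):=\int_0^x y\,m(dy)\le Cx^\rho\quad\forall x\in(0,1).$$ Then for every $t>0$ there exists $A_t<\infty$ such that $\mathbb{P}_x(t<\tau_\partial)\le A_t\,x$ for all $x>0$.
   Context: A diffusion on $[0,\infty)$ on natural scale with speed measure $m$ (locally finite positive measure on $(0,\infty)$ charging every nonempty open subset), absorbed at $0$: $X_t=B_{\sigma_t}$ for $t<\tau_\partial$, $X_t=0$ after, with $B$ standard Brownian motion, $A_s=\int L^y_s m(dy)$ ($L^y$ local times), $\sigma_t=\inf\{s:A_s>t\}$, $\tau_\partial$ the first hitting time of $0$. $X$ comes down from infinity iff $\int_1^\infty y\,m(dy)<\infty$; it hits $0$ in a.s. finite time iff $\int_0^1 y\,m(dy)<\infty$. *)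

(* Defs.v *)
From HB Require Import structures.
From mathcomp Require Import all_boot all_order all_algebra.
From mathcomp Require Import all_classical all_reals all_analysis.
Set Implicit Arguments.
Unset Strict Implicit.
Unset Printing Implicit Defensive.
Import Order.TTheory GRing.Theory Num.Theory.
Import numFieldNormedType.Exports.
Local Open Scope classical_set_scope.
Local Open Scope ring_scope.

Section Defs.
Context {R : realType} {d : measure_display} {T : measurableType d}.

Definition std_brownian (P : probability T R) (W : R -> T -> R) : Prop :=
  [/\ (forall t, measurable_fun [set: T] (W t)),
      (forall w, W 0 w = 0),
      (forall w, {within `[0, +oo[, continuous (fun s => W s w)}) &
      (forall (n : nat) (tt : nat -> R) (A : nat -> set R),
         tt 0%N = 0 ->
         (forall i, (i < n)%N -> tt i < tt i.+1) ->
         (forall i, (i < n)%N -> measurable (A i)) ->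
         P (\bigcap_(i in [set i | (i < n)%N])
              [set w | A i (W (tt i.+1) w - W (tt i) w)]) =
         (\prod_(i < n) normal_prob 0 (Num.sqrt (tt i.+1 - tt i)) (A i))%E)].

Definition local_time (B : R -> T -> R) (L : R -> R -> T -> R) : Prop :=
  forall w,
  [/\ (forall y s, 0 <= L y s w),
      {within [set p : R * R | 0 <= p.2],
         continuous (fun p : R * R => L p.1 p.2 w)} &
      (forall s, 0 <= s -> forall A : set R, measurable A ->
         lebesgue_measure (`[0, s]%classic `&` [set u | A (B u w)]) =
         (\int[lebesgue_measure]_(y in A) (L y s w)%:E)%E)].

Definition speed_measure (m : {measure set R -> \bar R}) : Prop :=
  [/\ m `]-oo, 0]%classic = 0%E,
      (forall a b, 0 < a -> a <= b -> (m `[a, b]%classic < +oo)%E) &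
      (forall a b, 0 <= a -> a < b -> (0 < m `]a, b[%classic)%E)].

(** Time-change construction for the diffusion started at [x]:
    B = x + W, whose local time at level y is L^{y-x}(W). *)
Definition add_fun (W : R -> T -> R) (L : R -> R -> T -> R)
  (m : {measure set R -> \bar R}) (x s : R) (w : T) : \bar R :=
  (\int[m]_(y in [set y : R | (0 < y)%R]) (L (y - x) s w)%:E)%E.

Definition time_change W L m (x t : R) (w : T) : \bar R :=
  ereal_inf [set s%:E | s in [set s : R | 0 <= s /\ (t%:E < add_fun W L m x s w)%E]].

Definition X_at_zero W L m (x t : R) (w : T) : Prop :=
  time_change W L m x t w \is a fin_num /\
  x + W (fine (time_change W L m x t w)) w = 0.

Definition absorption_time W L m (x : R) (w : T) : \bar R :=
  ereal_inf [set u%:E | u in [set u : R | 0 <= u /\ X_at_zero W L m x u w]].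

End Defs.

(* Main.v *)
Require Import Defs.
From HB Require Import structures.
From mathcomp Require Import all_boot all_order all_algebra.
From mathcomp Require Import all_classical all_reals all_analysis.
From mathcomp Require Import measurable_realfun ring lra.

(* The lifetime of X is A at the hitting time of 0, that is the integral against m(dy)
   of the local time l(y) of B = x + W at level y before that time.
   Exponential moments of l(y): let u be a concave smoothing of 1 + c + 2 min(z, y) / y,
   with -u'' concentrated near y. Along the Gaussian random walk W(j delta) killed on
   leaving (0, oo), u(S_j) exp(lambda delta sum_(i < j) (-u''(S_i))) is a supermartingale
   up to errors vanishing with delta. By Fatou, exp(kappa l(y) / y) is dominated by some
   Psi >= 1 of mean at most 1 + 3 x / y.
   Tail of the lifetime: (l - b)^+ <= exp(-a b) (exp(a l) - 1) / a, with a = kappa / y, gives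
   E (l(y) - b(y))^+ <= (3 x / kappa) exp(-kappa b(y) / y). For b(y) proportional to
   y^(1 - rho / 2) on (0, 1] and 0 beyond, the right-hand side is at most K x y, which is
   m-integrable, while the assumption on I makes b itself integrable: scaled so that its
   integral is t / 2, the lifetime exceeds t only if the integral of (l(y) - b(y))^+ is at
   least t / 2, and Markov's inequality concludes.
   The absorption time, defined through the time change, coincides with the lifetime
   as soon as the path returns above 0 after it has been below, which it does almost
   surely. *)

Set Implicit Arguments.
Unset Strict Implicit.
Unset Printing Implicit Defensive.
Import Order.TTheory GRing.Theory Num.Theory.
Import numFieldNormedType.Exports.
Local Open Scope classical_set_scope.
Local Open Scope ring_scope.

(** * Gaussian estimates *)

Section Gaussian.
Context {R : realType}.
Local Notation mu := (@lebesgue_measure R).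
Local Notation gamma s := (@normal_prob R 0 s).

(** A first-moment bound cannot suffice: l(y) has mean 2 min(x, y), so the mean lifetime is the
    integral of 2 min(x, y) against m, which need not be O(x) because m may have infinite mass near
    0. Each level near 0 is therefore granted a deterministic budget b(y), and only the excess is
    averaged; it is O(x) because the exponential moment exceeds 1 by O(x / y) only. The
    supermartingale is of Khas'minskii type: u stays bounded uniformly in y while -u'' has total
    mass 2 / y, which gives the rate kappa / y that Brownian scaling predicts. Brownian motion
    enters only through the law of its increments on finite grids and the pathwise occupation
    formula. Tanaka's identity is thus replaced by a Taylor expansion over one Gaussian step of
    standard deviation s, with an error of order s^3; s^-2 steps per unit time make the total error
    of order s. This asks for a smooth u, hence a smoothing width e that is fixed while the mesh
    vanishes and is sent to 0 afterwards. *)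

Lemma ge0_integral_normal_prob (s : R) (f : R -> \bar R) : s != 0 ->
  measurable_fun [set: R] f -> (forall x, 0 <= f x)%E ->
  (\int[gamma s]_x f x = \int[mu]_x (f x * (normal_pdf 0 s x)%:E))%E.
Proof.
move=> s0 mf f0.
have dom := @normal_prob_dominates R 0 s.
rewrite -(@Radon_Nikodym_SigmaFinite.change_of_variables _ _ R (normal_prob 0 s) mu dom f setT)//.
set g := Radon_Nikodym_SigmaFinite.f _ _.
have mg : measurable_fun setT g.
  by have /integrableP[] := Radon_Nikodym_SigmaFinite.f_integrable dom.
have mp : measurable_fun [set: R] (fun x => (normal_pdf 0 s x)%:E).
  by apply/measurable_EFinP; exact: measurable_normal_pdf.
have ae : ae_eq mu setT g (fun x => (normal_pdf 0 s x)%:E).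
  apply: integral_ae_eq => //.
    exact: Radon_Nikodym_SigmaFinite.f_integrable.
  move=> E _ mE; rewrite -[RHS]/(normal_prob 0 s E).
  by rewrite -(Radon_Nikodym_SigmaFinite.f_integral dom).
apply: ae_eq_integral => //.
- exact: emeasurable_funM.
- exact: emeasurable_funM.
- exact: ae_eqe_mul2l.
Qed.

Lemma normal_pdfN (s x : R) : s != 0 -> normal_pdf 0 s (- x) = normal_pdf 0 s x.
Proof. by move=> s0; rewrite normal_pdfE// /normal_fun !subr0 sqrrN. Qed.

Lemma ge0_integral_normal_probN (s : R) (f : R -> \bar R) : s != 0 ->
  measurable_fun [set: R] f -> (forall x, 0 <= f x)%E ->
  (\int[gamma s]_x f (- x)%R = \int[gamma s]_x f x)%E.
Proof.
move=> s0 mf f0.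
have mN : measurable_fun [set: R] (-%R : R -> R) by exact: oppr_measurable.
rewrite !ge0_integral_normal_prob//; last first.
  exact: (measurableT_comp mf).
pose g x := (f x * (normal_pdf 0 s x)%:E)%E.
have mg : measurable_fun setT g.
  by apply: emeasurable_funM => //; apply/measurable_EFinP; exact: measurable_normal_pdf.
have g0 x : (0 <= g x)%E by rewrite mule_ge0// lee_fin normal_pdf_ge0.
transitivity (\int[pushforward mu (-%R : _ -> measurableTypeR R)]_x g x)%E; last first.
  apply: eq_measure_integral => A mA _; exact: lebesgue_measureN.
transitivity (\int[mu]_x (g \o -%R) x)%E; last first.
  apply/esym; exact: (@ge0_integral_pushforward _ _ (measurableTypeR R) (measurableTypeR R) R -%R mN mu setT g measurableT mg (fun y _ => g0 y)).
apply: eq_integral => x _.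
by rewrite /g /= normal_pdfN.
Qed.


(** Lower bound, uniform in s, for the mass that the centred normal law of standard deviation s
    gives to [s, 2 s]: the length s times the density at 2 s. *)
Definition gauss_mass : R := (Num.sqrt (pi *+ 2))^-1 * expR (- 2).

Lemma gauss_mass_gt0 : 0 < gauss_mass.
Proof.
by rewrite mulr_gt0 ?expR_gt0// invr_gt0 sqrtr_gt0 mulrn_wgt0// pi_gt0.
Qed.

Lemma normal_peakE (s : R) : 0 < s -> normal_peak s = s^-1 * (Num.sqrt (pi *+ 2))^-1.
Proof.
move=> s0; rewrite /normal_peak -mulrnAr sqrtrM ?sqr_ge0// sqrtr_sqr gtr0_norm//.
by rewrite invfM.
Qed.

Lemma normal_prob_ge (s : R) : 0 < s -> (gauss_mass%:E <= gamma s `[s, (2 * s)%R]%classic)%E.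
Proof.
move=> s0; rewrite /normal_prob.
have s2 : s < 2 * s by rewrite mulr_natl mulr2n ltrDl.
apply: (@le_trans _ _ (\int[mu]_(x in `[s, (2 * s)%R]%classic) (gauss_mass / s)%:E)%E).
  rewrite integral_cst//= lebesgue_measure_itv/= lte_fin s2 -EFinB -EFinM lee_fin.
  by rewrite [X in X - _]mulr_natl mulr2n addrK divfK// gt_eqF.
apply: ge0_le_integral => //=.
- by move=> x _; rewrite lee_fin divr_ge0// ltW// gauss_mass_gt0.
- apply/measurable_EFinP; apply: measurable_funTS; exact: measurable_normal_pdf.
- move=> x; rewrite in_itv/= => /andP[sx x2s].
  rewrite lee_fin normal_pdfE ?gt_eqF// normal_peakE// /gauss_mass mulrC mulrA.
  rewrite ler_pM2l; last by rewrite mulr_gt0 ?invr_gt0// sqrtr_gt0 mulrn_wgt0// pi_gt0.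
  rewrite /normal_fun ler_expR subr0 mulNr lerN2 ler_pdivrMr; last first.
    by rewrite mulrn_wgt0// exprn_gt0.
  have : x ^+ 2 <= (2 * s) ^+ 2 by rewrite ler_sqr// ?nnegrE; lra.
  by rewrite exprMn -mulr_natl; lra.
Qed.

Lemma normal_prob_itvN (s : R) (A : set R) : s != 0 -> measurable A ->
  gamma s (-%R @^-1` A) = gamma s A.
Proof.
move=> s0 mA.
have mN : measurable_fun [set: R] (-%R : R -> R) by exact: oppr_measurable.
have mNA : measurable ((-%R : R -> R) @^-1` A) by rewrite -[X in measurable X]setTI; exact: mN.
transitivity (\int[gamma s]_x (\1_(-%R @^-1` A) x)%:E)%E.
  by rewrite integral_indic// setIT.
transitivity (\int[gamma s]_x (\1_A x)%:E)%E; last by rewrite integral_indic// setIT.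
rewrite -[RHS]ge0_integral_normal_probN//.
  by apply/measurable_EFinP; exact: measurable_indic.
Qed.

Lemma expR_ge_sqr4 (a : R) : 0 <= a -> a ^+ 2 / 4 <= expR a.
Proof.
move=> a0; have := expR_ge1Dx (a / 2) => h.
have -> : a = a / 2 + a / 2 by rewrite -splitr.
rewrite expRD -splitr.
have : (1 + a / 2) * (1 + a / 2) <= expR (a / 2) * expR (a / 2) by rewrite ler_pM//; lra.
by nra.
Qed.

(** Doubling the standard deviation frees a factor exp(-3 x^2 / (8 s^2)) that absorbs x^4, so the
    moment is compared with the total mass of the wider law; a constant larger than the exact 3 is
    harmless. *)
Lemma normal_prob_moment4 (s : R) : 0 < s ->
  (\int[gamma s]_x (x ^+ 4)%:E <= (64 * s ^+ 4)%:E)%E.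
Proof.
move=> s0.
rewrite ge0_integral_normal_prob ?gt_eqF//; last 2 first.
  by apply/measurable_EFinP; exact: measurable_funX.
  by move=> x; rewrite lee_fin exprn_even_ge0.
have -> : (64 * s ^+ 4)%:E = (\int[mu]_x ((64 * s ^+ 4)%:E * (normal_pdf 0 (2 * s) x)%:E))%E.
  rewrite ge0_integralZl_EFin//.
  - by rewrite integral_normal_pdf mule1.
  - by move=> x _; rewrite lee_fin normal_pdf_ge0.
  - by apply/measurable_EFinP; exact: measurable_normal_pdf.
  - by rewrite mulr_ge0// exprn_ge0// ltW.
apply: ge0_le_integral => //=.
- by move=> x _; rewrite -EFinM lee_fin mulr_ge0 ?exprn_even_ge0 ?normal_pdf_ge0.
- apply/measurable_EFinP; apply: measurable_funM; first exact: measurable_funX.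
  exact: measurable_normal_pdf.
- apply/measurable_EFinP; apply: measurable_funM => //; exact: measurable_normal_pdf.
- move=> x _; rewrite -!EFinM lee_fin !normal_pdfE ?gt_eqF ?mulr_gt0//.
  rewrite !normal_peakE ?mulr_gt0// invfM.
  set k := (Num.sqrt _)^-1.
  have k0 : 0 < k by rewrite invr_gt0 sqrtr_gt0 mulrn_wgt0// pi_gt0.
  rewrite /normal_fun !subr0.
  pose a := 3 / 8 * x ^+ 2 / s ^+ 2.
  have s2 : 0 < s ^+ 2 by rewrite exprn_gt0.
  have -> : - x ^+ 2 / (s ^+ 2 *+ 2) = - a + - x ^+ 2 / ((2 * s) ^+ 2 *+ 2).
    by rewrite /a; field; rewrite gt_eqF.
  rewrite expRD; set e := expR (- x ^+ 2 / _).
  have e0 : 0 <= e by exact: expR_ge0.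
  have key : x ^+ 4 * expR (- a) <= 32 * s ^+ 4.
    rewrite expRN ler_pdivrMr ?expR_gt0//.
    have a0 : 0 <= a by apply: divr_ge0; [apply: mulr_ge0; [lra|exact: sqr_ge0]|exact: sqr_ge0].
    apply: le_trans (_ : 32 * s ^+ 4 * (a ^+ 2 / 4) <= _); last first.
      by rewrite ler_wpM2l ?expR_ge_sqr4// mulr_ge0// exprn_ge0// ltW.
    have -> : 32 * s ^+ 4 * (a ^+ 2 / 4) = 9 / 8 * x ^+ 4.
      by rewrite /a; field; rewrite gt_eqF.
    by rewrite ler_peMl ?exprn_even_ge0//; lra.
  have -> : x ^+ 4 * (s^-1 * k * (expR (- a) * e)) = (x ^+ 4 * expR (- a)) * (s^-1 * k * e) by ring.
  have -> : 64 * s ^+ 4 * (2^-1 * s^-1 * k * e) = 32 * s ^+ 4 * (s^-1 * k * e) by field; rewrite gt_eqF.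
  by rewrite ler_wpM2r// mulr_ge0// mulr_ge0 ?(ltW k0)// invr_ge0 ltW.
Qed.

(* Adding the bound at v and -v cancels the linear term of the Taylor expansion. *)
Lemma normal_prob_step (s : R) (u : R -> R) (z b K : R) :
  0 < s <= 1 -> measurable_fun [set: R] u -> (forall v, 0 <= u v) ->
  0 <= b -> 0 <= K ->
  (forall v, u (z + v) + u (z - v) <=
     2 * u z - 2 * b * v ^+ 2 + 2 * K * (`|v| ^+ 3 + v ^+ 4)) ->
  (\int[gamma s]_v (u (z + v))%:E <=
     (u z - b * gauss_mass * s ^+ 2 + 129 * K * s ^+ 3)%:E)%E.
Proof.
move=> /andP[s0 s1] mu_ u0 b0 K0 h.
have mX n : measurable_fun [set: R] (fun v : R => v ^+ n) by exact: measurable_funX.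
have mup : measurable_fun [set: R] (fun v => u (z + v)).
  by apply: (measurableT_comp mu_); exact: measurable_funD.
have mum : measurable_fun [set: R] (fun v => u (z - v)).
  by apply: (measurableT_comp mu_); exact: measurable_funB.
set I := (\int[gamma s]_v (u (z + v))%:E)%E.
have I0 : (0 <= I)%E by apply: integral_ge0 => v _; rewrite lee_fin.
have IE : I = (\int[gamma s]_v (u (z - v))%:E)%E.
  by rewrite /I -ge0_integral_normal_probN ?gt_eqF//; [exact/measurable_EFinP|move=> v; rewrite lee_fin].
have m2 : ((gauss_mass * s ^+ 2)%:E <= \int[gamma s]_v (v ^+ 2)%:E)%E.
  apply: (@le_trans _ _ (\int[gamma s]_(v in `[s, (2 * s)%R]%classic) (s ^+ 2)%:E)%E).
    by rewrite integral_cst//= mulrC EFinM lee_wpmul2l ?lee_fin ?sqr_ge0// normal_prob_ge.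
  apply: (@le_trans _ _ (\int[gamma s]_(v in `[s, (2 * s)%R]%classic) (v ^+ 2)%:E)%E).
    apply: ge0_le_integral => //=.
    - by move=> v _; rewrite lee_fin sqr_ge0.
    - by apply/measurable_EFinP; apply: measurable_funTS.
    - move=> v; rewrite in_itv/= => /andP[sv _]; rewrite lee_fin ler_sqr// nnegrE; lra.
  apply: ge0_subset_integral => //=; first by apply/measurable_EFinP.
  by move=> v _; rewrite lee_fin sqr_ge0.
have main : (I + I + (2 * b)%:E * \int[gamma s]_v (v ^+ 2)%:E <=
    (2 * u z + 258 * K * s ^+ 3)%:E)%E.
  rewrite {2}IE /I -ge0_integralZl_EFin//=; last 3 first.
  - by move=> v _; rewrite lee_fin sqr_ge0.
  - by apply/measurable_EFinP.
  - by rewrite mulr_ge0.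
  rewrite -ge0_integralD//=; last 4 first.
  - by move=> v _; rewrite lee_fin.
  - by apply/measurable_EFinP.
  - by move=> v _; rewrite lee_fin.
  - by apply/measurable_EFinP.
  rewrite -ge0_integralD//=; last 4 first.
  - by move=> v _; rewrite adde_ge0 ?lee_fin.
  - by apply: emeasurable_funD; apply/measurable_EFinP.
  - by move=> v _; rewrite -EFinM lee_fin mulr_ge0 ?sqr_ge0 ?mulr_ge0.
  - by apply: emeasurable_funM => //; apply/measurable_EFinP.
  (* By |v|^3 <= s^3 + v^4 / s, the errors reduce to a constant and the fourth moment; as s <= 1,
     they add up to 1 + 64 + 64 = 129. *)
  pose c1 := 2 * u z + 2 * K * s ^+ 3; pose c2 := 2 * K * (s^-1 + 1).
  have c10 : 0 <= c1 by rewrite /c1 addr_ge0// ?mulr_ge0// ?exprn_ge0// ltW.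
  have c20 : 0 <= c2 by rewrite /c2 !mulr_ge0// addr_ge0// invr_ge0 ltW.
  apply: (@le_trans _ _ (\int[gamma s]_v (c1%:E + c2%:E * (v ^+ 4)%:E))%E).
    apply: ge0_le_integral => //=.
    - by move=> v _; rewrite -EFinM !adde_ge0 ?lee_fin// mulr_ge0 ?sqr_ge0 ?mulr_ge0.
    - apply: emeasurable_funD; last by apply: emeasurable_funM => //; apply/measurable_EFinP.
      by apply: emeasurable_funD; apply/measurable_EFinP.
    - apply: emeasurable_funD => //.
      by apply: emeasurable_funM => //; apply/measurable_EFinP.
    - move=> v _; rewrite -!EFinM -!EFinD lee_fin.
      have := h v.
      have : `|v| ^+ 3 <= s ^+ 3 + v ^+ 4 / s.
        have v4 : v ^+ 4 = `|v| ^+ 4 by rewrite -normrX ger0_norm// exprn_even_ge0.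
        rewrite v4; have [vs|/ltW sv] := lerP `|v| s.
          rewrite -[leLHS]addr0 lerD ?divr_ge0// ?exprn_ge0// ?(ltW s0)//.
          by rewrite lerXn2r// nnegrE ltW.
        rewrite -[leLHS]add0r lerD// ?exprn_ge0// ?(ltW s0)//.
        by rewrite ler_pdivlMr// [leRHS]exprSr ler_wpM2l// exprn_ge0.
      rewrite /c1 /c2 => h1 h2.
      have : 2 * K * `|v| ^+ 3 <= 2 * K * (s ^+ 3 + v ^+ 4 / s) by rewrite ler_wpM2l// mulr_ge0.
      have -> : 2 * K * (s^-1 + 1) * v ^+ 4 = 2 * K * (v ^+ 4 / s) + 2 * K * v ^+ 4 by ring.
      by lra.
  rewrite ge0_integralD//=; last 2 first.
  - by move=> v _; rewrite -EFinM lee_fin mulr_ge0// exprn_even_ge0.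
  - by apply: emeasurable_funM => //; apply/measurable_EFinP.
  rewrite integral_cst//= probability_setT mule1.
  rewrite ge0_integralZl_EFin//=; last 2 first.
  - by move=> v _; rewrite lee_fin exprn_even_ge0.
  - by apply/measurable_EFinP.
  apply: (@le_trans _ _ (c1%:E + c2%:E * (64 * s ^+ 4)%:E)%E).
    by rewrite leeD2l// lee_wpmul2l ?lee_fin// normal_prob_moment4.
  rewrite -EFinM -EFinD lee_fin /c1 /c2.
  have -> : 2 * K * (s^-1 + 1) * (64 * s ^+ 4) = 128 * K * s ^+ 3 + 128 * (K * s ^+ 3) * s.
    by field; rewrite gt_eqF.
  have : K * s ^+ 3 * s <= K * s ^+ 3 by rewrite ler_piMr// mulr_ge0// exprn_ge0// ltW.
  by lra.
have {main} : (I + I + (2 * b)%:E * (gauss_mass * s ^+ 2)%:E <=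
    (2 * u z + 258 * K * s ^+ 3)%:E)%E.
  apply: le_trans main; rewrite leeD2l// lee_wpmul2l ?lee_fin ?mulr_ge0//.
case: I I0 {IE} => [i i0| |]//=.
rewrite -EFinM -!EFinD !lee_fin => hh; lra.
Qed.

End Gaussian.

(** * The potential of the killed walk *)

Section Potential.
Context {R : realType}.
Implicit Types a e v x y z c : R.

(** Smoothing of [|v|] at scale [e], with second derivative [e ^+ 2 / hyp e v ^+ 3]. *)
Definition hyp e v : R := Num.sqrt (v ^+ 2 + e ^+ 2).

Lemma sqr_hyp e v : hyp e v ^+ 2 = v ^+ 2 + e ^+ 2.
Proof. by rewrite sqr_sqrtr// addr_ge0// sqr_ge0. Qed.

Lemma hyp_ge0 e v : 0 <= hyp e v. Proof. exact: sqrtr_ge0. Qed.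

Lemma hyp_ge e v : 0 < e -> e <= hyp e v.
Proof.
move=> e0; rewrite -(@ler_pXn2r _ 2)// ?nnegrE ?hyp_ge0 ?(ltW e0)// sqr_hyp.
by rewrite lerDr sqr_ge0.
Qed.

Lemma hyp_gt0 e v : 0 < e -> 0 < hyp e v.
Proof. by move=> e0; apply: lt_le_trans (hyp_ge v e0). Qed.

Lemma norm_le_hyp e v : `|v| <= hyp e v.
Proof.
rewrite -(@ler_pXn2r _ 2)// ?nnegrE ?hyp_ge0// sqr_hyp.
by rewrite real_normK ?num_real// lerDl sqr_ge0.
Qed.

Lemma hypN e v : hyp e (- v) = hyp e v. Proof. by rewrite /hyp sqrrN. Qed.

Lemma hyp_lip e a v : hyp e (a + v) <= hyp e a + `|v|.
Proof.
rewrite -(@ler_pXn2r _ 2)// ?nnegrE ?hyp_ge0 ?addr_ge0 ?hyp_ge0//.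
rewrite sqr_hyp [leRHS]sqrrD sqr_hyp real_normK ?num_real// sqrrD.
have : a * v <= hyp e a * `|v|.
  apply: le_trans (ler_norm _) _; rewrite normrM ler_wpM2r//; exact: norm_le_hyp.
by lra.
Qed.

(** No derivative is taken. If the quadratic polynomial q exceeds r', then e (q - r') <= (q + r') (q
    - r') = q^2 - r'^2, and this difference is the explicit D, in which all terms of order at most
    two in v cancel. *)
Lemma hyp_taylor e a v : 0 < e ->
  hyp e a + a * v / hyp e a + e ^+ 2 * v ^+ 2 / (2 * hyp e a ^+ 3)
    - (`|v| ^+ 3 / e ^+ 2 + v ^+ 4 / e ^+ 3) <= hyp e (a + v).
Proof.
move=> e0; set r := hyp e a; set r' := hyp e (a + v).
set q := r + _ + _; set k := `|v| ^+ 3 / _ + _.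
have k0 : 0 <= k.
  by apply: addr_ge0; apply: divr_ge0 => //; rewrite ?(exprn_ge0 _ (ltW e0)) ?(exprn_ge0 _ (normr_ge0 v)) ?exprn_even_ge0.
have r0 : 0 < r by exact: hyp_gt0.
have re : e <= r by exact: hyp_ge.
have r'e : e <= r' by exact: hyp_ge.
have rE : r ^+ 2 = a ^+ 2 + e ^+ 2 by exact: sqr_hyp.
have r'E : r' ^+ 2 = (a + v) ^+ 2 + e ^+ 2 by exact: sqr_hyp.
have ar : `|a| <= r by exact: norm_le_hyp.
have [qr|rq] := lerP q r'; first by lra.
pose D := a * e ^+ 2 * v ^+ 3 / r ^+ 4 + e ^+ 4 * v ^+ 4 / (4 * r ^+ 6).
have DE : q ^+ 2 - r' ^+ 2 = D.
  have a2 : a ^+ 2 = r ^+ 2 - e ^+ 2 by rewrite rE addrK.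
  rewrite r'E [(a + v) ^+ 2]sqrrD a2 /q /D.
  have -> : (r + a * v / r + e ^+ 2 * v ^+ 2 / (2 * r ^+ 3)) ^+ 2 =
     r ^+ 2 + a ^+ 2 * v ^+ 2 / r ^+ 2 + e ^+ 4 * v ^+ 4 / (4 * r ^+ 6) + 2 * a * v
      + e ^+ 2 * v ^+ 2 / r ^+ 2 + a * e ^+ 2 * v ^+ 3 / r ^+ 4.
    by field; rewrite gt_eqF.
  by rewrite a2; field; rewrite gt_eqF.
have Dk : D <= e * k.
  have d1 : a * e ^+ 2 * v ^+ 3 / r ^+ 4 <= `|v| ^+ 3 / e.
    apply: le_trans (_ : `|a| * e ^+ 2 * `|v| ^+ 3 / r ^+ 4 <= _).
      rewrite ler_wpM2r ?invr_ge0 ?exprn_ge0 ?(ltW r0)//.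
      apply: le_trans (ler_norm _) _.
      by rewrite 2!normrM normrX normrX (gtr0_norm e0).
    have -> : `|a| * e ^+ 2 * `|v| ^+ 3 / r ^+ 4 = (`|v| ^+ 3 / e) * ((e ^+ 3 * `|a|) / r ^+ 4).
      by field; rewrite !gt_eqF.
    rewrite ler_piMr ?divr_ge0 ?exprn_ge0 ?(ltW e0)//.
    rewrite ler_pdivrMr ?exprn_gt0// mul1r [leRHS]exprSr ler_pM ?exprn_ge0 ?(ltW e0)//.
    by rewrite lerXn2r// nnegrE ltW.
  have d2 : e ^+ 4 * v ^+ 4 / (4 * r ^+ 6) <= v ^+ 4 / e ^+ 2.
    have -> : e ^+ 4 * v ^+ 4 / (4 * r ^+ 6) = (v ^+ 4 / e ^+ 2) * (e ^+ 6 / (4 * r ^+ 6)).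
      by field; rewrite !gt_eqF.
    rewrite ler_piMr ?divr_ge0 ?exprn_even_ge0//.
    rewrite ler_pdivrMr ?mulr_gt0 ?exprn_gt0// mul1r.
    apply: le_trans (_ : r ^+ 6 <= _); first by rewrite lerXn2r// nnegrE ltW.
    by rewrite ler_peMl ?exprn_ge0 ?(ltW r0)//; lra.
  rewrite /D /k; apply: le_trans (lerD d1 d2) _.
  by rewrite le_eqVlt; apply/orP; left; apply/eqP; field; rewrite gt_eqF.
have : e * (q - r') <= e * k.
  apply: le_trans Dk; rewrite -DE subr_sqr mulrC ler_wpM2l ?subr_ge0 ?(ltW rq)//.
  by lra.
by rewrite ler_pM2l//; lra.
Qed.

(* A smoothing of 2 min(z, y); fpot is the opposite of its second derivative. *)
Definition hpot e y z : R := z + hyp e y - hyp e (z - y).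
Definition upot e y c z : R := Num.max 1 (1 + c + hpot e y z / y).
Definition fpot e y z : R := e ^+ 2 / hyp e (z - y) ^+ 3.

Lemma hpot_lip e y z v : `|hpot e y (z + v) - hpot e y z| <= 2 * `|v|.
Proof.
rewrite /hpot.
have -> : z + v + hyp e y - hyp e (z + v - y) - (z + hyp e y - hyp e (z - y)) =
  v - (hyp e (z - y + v) - hyp e (z - y)).
  by rewrite (addrAC z v (- y)); ring.
apply: le_trans (ler_normB _ _) _; rewrite mulr_natl mulr2n lerD2l ler_norml.
have := hyp_lip e (z - y) v; have := hyp_lip e (z - y + v) (- v).
by rewrite addrK normrN => ? ?; apply/andP; split; lra.
Qed.

Lemma hpot_ge0 e y z : 0 <= z -> 0 <= hpot e y z.
Proof.
move=> z0; rewrite /hpot; have := hyp_lip e (- y) z.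
by rewrite hypN ger0_norm// addrC; lra.
Qed.

Lemma hpot_le2 e y z : 0 <= z -> hpot e y z <= 2 * z.
Proof.
move=> z0; have := hpot_lip e y 0 z; rewrite add0r.
have -> : hpot e y 0 = 0 by rewrite /hpot add0r sub0r hypN subrr.
by rewrite subr0 (ger0_norm z0) ger0_norm ?hpot_ge0.
Qed.

Lemma hpot_le3 e y z : 0 < e <= y -> hpot e y z <= 3 * y.
Proof.
move=> /andP[e0 ey]; rewrite /hpot.
have h1 : z - y <= hyp e (z - y) by apply: le_trans (ler_norm _) (norm_le_hyp _ _).
have h2 : hyp e y <= y + e.
  have := hyp_lip e 0 y; rewrite add0r (gtr0_norm (lt_le_trans e0 ey)).
  by rewrite {2}/hyp expr0n add0r sqrtr_sqr gtr0_norm//; lra.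
by lra.
Qed.

Lemma upot_ge1 e y c z : 1 <= upot e y c z.
Proof. by rewrite /upot le_max lexx. Qed.

Lemma upotE e y c z : 0 < y -> 0 <= c -> 0 <= z -> upot e y c z = 1 + c + hpot e y z / y.
Proof.
move=> y0 c0 z0; apply/max_idPr.
by rewrite -addrA lerDl addr_ge0// divr_ge0 ?hpot_ge0// ltW.
Qed.

Lemma upot_le e y c x : 0 < y -> 0 <= c -> 0 <= x -> upot e y c x <= 1 + c + 2 * x / y.
Proof.
move=> y0 c0 x0; rewrite upotE// lerD2l ler_wpM2r ?invr_ge0 ?(ltW y0)//.
exact: hpot_le2.
Qed.

Lemma upot_le5 e y c z : 0 < e <= y -> 0 <= c <= 1 -> upot e y c z <= 5.
Proof.
move=> ey /andP[c0 c1]; rewrite /upot ge_max; apply/andP; split; first lra.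
have y0 : 0 < y by case/andP: ey => e0; exact: lt_le_trans.
have : hpot e y z / y <= 3 by rewrite ler_pdivrMr// hpot_le3.
by lra.
Qed.

Lemma fpot_ge0 e y z : 0 <= fpot e y z.
Proof. by rewrite divr_ge0 ?sqr_ge0// exprn_ge0// hyp_ge0. Qed.

Lemma fpot_le e y z : 0 < e -> fpot e y z <= e^-1.
Proof.
move=> e0; rewrite /fpot ler_pdivrMr ?exprn_gt0 ?hyp_gt0// mulrC ler_pdivlMr//.
by rewrite -exprSr lerXn2r ?nnegrE ?hyp_ge0 ?(ltW e0)// hyp_ge.
Qed.

(** The radius is 2 e because a path within e of y has its neighbouring grid value within 2 e. There
    [hyp] is at most 3 e, whence 27. *)
Lemma fpot_ge e y z : 0 < e -> `|z - y| <= 2 * e -> (27 * e)^-1 <= fpot e y z.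
Proof.
move=> e0 zy; rewrite /fpot.
have h3 : hyp e (z - y) <= 3 * e.
  have := hyp_lip e 0 (z - y); rewrite add0r.
  by rewrite {2}/hyp expr0n add0r sqrtr_sqr gtr0_norm//; lra.
rewrite ler_pdivlMr ?exprn_gt0 ?hyp_gt0// ler_pdivrMl ?mulr_gt0//.
apply: le_trans (_ : (3 * e) ^+ 3 <= _).
  by rewrite lerXn2r ?nnegrE ?hyp_ge0// mulr_ge0// ltW.
by rewrite exprMn; rewrite le_eqVlt; apply/orP; left; apply/eqP; ring.
Qed.

(** One coefficient for both |v|^3 and v^4: the first summand collects the remainders of
    [hyp_taylor], the second is the cost of clipping. *)
Definition kpot e y c : R := (e ^- 2 + e ^- 3) / y + 8 / (c ^+ 2 * y ^+ 3).

Lemma kpot_ge0 e y c : 0 < e -> 0 < y -> 0 <= kpot e y c.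
Proof.
move=> e0 y0; have := ltW e0; have := ltW y0 => ? ?.
rewrite /kpot; apply: addr_ge0; apply: divr_ge0 => //.
  by apply: addr_ge0; rewrite invr_ge0 exprn_ge0.
by apply: mulr_ge0; rewrite ?sqr_ge0 ?exprn_ge0.
Qed.

(* The clipping at 1 is only active after a jump of size at least c y / 2. *)
Lemma upot_clip e y c z v : 0 < y -> 0 < c -> 0 <= z ->
  upot e y c (z + v) <= 1 + c + hpot e y (z + v) / y + 8 / (c ^+ 2 * y ^+ 3) * `|v| ^+ 3.
Proof.
move=> y0 c0 z0.
have c2y : 0 < c ^+ 2 * y ^+ 3 by rewrite mulr_gt0// exprn_gt0.
have k0 : 0 <= 8 / (c ^+ 2 * y ^+ 3) * `|v| ^+ 3.
  by rewrite mulr_ge0 ?exprn_ge0// divr_ge0// ltW.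
rewrite /upot ge_max; apply/andP; split; last by rewrite lerDl.
have [?|neg] := lerP 0 (c + hpot e y (z + v) / y); first by lra.
have := hpot_lip e y z v; rewrite ler_norml => /andP[lo _].
have hz := @hpot_ge0 e y z z0.
have hv : - (hpot e y (z + v) / y) <= 2 * `|v| / y.
  by rewrite -mulNr ler_wpM2r ?invr_ge0 ?(ltW y0)//; lra.
have cv : c * y <= 2 * `|v|.
  by rewrite -ler_pdivlMr//; lra.
have -> : 8 / (c ^+ 2 * y ^+ 3) * `|v| ^+ 3 = (2 * `|v| / y) * ((2 * `|v|) ^+ 2 / (c * y) ^+ 2).
  by field; rewrite !gt_eqF.
have : 2 * `|v| / y <= (2 * `|v| / y) * ((2 * `|v|) ^+ 2 / (c * y) ^+ 2).
  rewrite ler_peMr ?divr_ge0 ?mulr_ge0 ?(ltW y0)//.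
  rewrite ler_pdivlMr ?exprn_gt0 ?mulr_gt0// mul1r lerXn2r// nnegrE ?mulr_ge0// ltW//.
by lra.
Qed.

Lemma upot_second_difference e y c z v : 0 < e -> 0 < y -> 0 < c -> 0 <= z ->
  upot e y c (z + v) + upot e y c (z - v) <=
    2 * upot e y c z - 2 * (fpot e y z / (2 * y)) * v ^+ 2
      + 2 * kpot e y c * (`|v| ^+ 3 + v ^+ 4).
Proof.
move=> e0 y0 c0 z0.
have := @upot_clip e y c z v y0 c0 z0; have := @upot_clip e y c z (- v) y0 c0 z0.
rewrite normrN (upotE e y0 (ltW c0) z0).
have := @hyp_taylor e (z - y) v e0; have := @hyp_taylor e (z - y) (- v) e0.
rewrite normrN sqrrN !mulrN !mulNr.
have -> : (- v) ^+ 4 = v ^+ 4 by rewrite exprNn -signr_odd mul1r.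
set r := hyp e (z - y).
have r0 : 0 < r by exact: hyp_gt0.
set w := `|v| ^+ 3; set w4 := v ^+ 4.
have w0 : 0 <= w by rewrite exprn_ge0.
have w40 : 0 <= w4 by rewrite exprn_even_ge0.
set T1 := (z - y) * v / r; set T2 := e ^+ 2 * v ^+ 2 / _.
set A := w / e ^+ 2 + w4 / e ^+ 3 => t1 t2.
have : hpot e y (z + v) + hpot e y (z - v) <= 2 * hpot e y z - 2 * T2 + 2 * A.
  rewrite /hpot -/r (addrAC z v (- y)) (addrAC z (- v) (- y)).
  by lra.
move=> hh; set B := 8 / _ => c1 c2.
have hy : hpot e y (z + v) / y + hpot e y (z - v) / y <=
  2 * (hpot e y z / y) - 2 * T2 / y + 2 * A / y.
  have -> : 2 * (hpot e y z / y) - 2 * T2 / y + 2 * A / y = (2 * hpot e y z - 2 * T2 + 2 * A) / y by ring.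
  by rewrite -mulrDl ler_wpM2r// invr_ge0 ltW.
have fE : 2 * (fpot e y z / (2 * y)) * v ^+ 2 = 2 * T2 / y.
  by rewrite /fpot -/r /T2; field; rewrite !gt_eqF.
have AK : A / y + B * w <= kpot e y c * (w + w4).
  have -> : kpot e y c * (w + w4) = A / y + B * w + ((w4 / e ^+ 2 + w / e ^+ 3) / y + B * w4).
    by rewrite /kpot -/B /A; field; rewrite !gt_eqF.
  have B0 : 0 <= B by rewrite divr_ge0// mulr_ge0 ?sqr_ge0// exprn_ge0// ltW.
  have e2 n : 0 <= e ^+ n by rewrite exprn_ge0// ltW.
  rewrite lerDl; apply: addr_ge0; last exact: mulr_ge0.
  by apply: divr_ge0; [apply: addr_ge0; exact: divr_ge0|exact: ltW].
rewrite fE.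
have -> : 2 * kpot e y c * (w + w4) = 2 * (kpot e y c * (w + w4)) by rewrite mulrA.
have AE : 2 * A / y = 2 * (A / y) by rewrite mulrA.
by rewrite AE in hy; lra.
Qed.

Lemma continuous_hyp e : continuous (hyp e : R -> R).
Proof.
move=> v; apply: (@continuous_comp _ _ _ (fun v => v ^+ 2 + e ^+ 2) (@Num.sqrt R)).
  by apply: cvgD; [exact: exprn_continuous|exact: cvg_cst].
exact: sqrt_continuous.
Qed.

Lemma measurable_hyp e : measurable_fun [set: R] (hyp e).
Proof. by apply: continuous_measurable_fun; exact: continuous_hyp. Qed.

Lemma measurable_upot e y c : measurable_fun [set: R] (upot e y c).
Proof.
apply: measurable_maxr => //; apply: measurable_funD => //.
apply: measurable_funM => //; apply: measurable_funB; first exact: measurable_funD.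
by apply: (measurableT_comp (measurable_hyp e)); exact: measurable_funB.
Qed.

Lemma measurable_fpot e y : 0 < e -> measurable_fun [set: R] (fpot e y).
Proof.
move=> e0; apply: continuous_measurable_fun => z.
apply: cvgM; first exact: cvg_cst.
apply: cvgV; first by rewrite gt_eqF// exprn_gt0// hyp_gt0.
apply: (@continuous_comp _ _ _ (fun z => hyp e (z - y)) (fun t => t ^+ 3)).
  apply: (@continuous_comp _ _ _ (fun z => z - y) (hyp e)).
    by apply: cvgB; [exact: cvg_id|exact: cvg_cst].
  exact: continuous_hyp.
exact: exprn_continuous.
Qed.

End Potential.

(** * Integration along independent steps *)

Section Independence.
Context {R : realType} {d : measure_display} {T : measurableType d} {P : probability T R}.
Context {d' : measure_display} {U : measurableType d'}.
Local Notation RT := (measurableTypeR R).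
Variables (xi : nat -> T -> RT) (gam : nat -> probability RT R).
Hypothesis mxi : forall i, measurable_fun [set: T] (xi i).
Hypothesis ind : forall n (A : nat -> set RT), (forall i, measurable (A i)) ->
  P (\bigcap_(i in [set i | (i < n)%N]) (xi i @^-1` A i)) =
  (\prod_(i < n) gam i (A i))%E.
Variables (Y : nat -> T -> U) (Phi : nat -> U * RT -> U) (y0 : U).
Hypothesis mPhi : forall j, measurable_fun [set: U * RT] (Phi j).
Hypothesis Y0 : forall w, Y 0 w = y0.
Hypothesis YS : forall j w, Y j.+1 w = Phi j (Y j w, xi j w).

Lemma chain_measurable j : measurable_fun [set: T] (Y j).
Proof.
elim: j => [|j IH].
  rewrite (_ : Y 0 = cst y0); first exact: measurable_cst.
  by apply/funext => w; rewrite Y0.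
rewrite (_ : Y j.+1 = Phi j \o (fun w => (Y j w, xi j w))); last first.
  by apply/funext => w; rewrite YS.
by apply: measurableT_comp => //; exact: measurable_fun_pair.
Qed.

Lemma chain_pair_measurable j : measurable_fun [set: T] (fun w => (Y j w, xi j w)).
Proof. apply: measurable_fun_pair => //; exact: chain_measurable. Qed.

HB.instance Definition _ j := isMeasurableFun.Build _ _ _ _ (Y j) (chain_measurable j).

Let future j n (A : nat -> set RT) := \bigcap_(i in [set i | (j <= i < n)%N]) (xi i @^-1` A i).

Let mfuture j n A : (forall i, measurable (A i)) -> measurable (future j n A).
Proof.
move=> mA; apply: bigcap_measurableType => i _.
by rewrite -[X in measurable X]setTI; exact: mxi.
Qed.

Let futureS j n A : (j < n)%N -> future j n A = xi j @^-1` A j `&` future j.+1 n A.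
Proof.
move=> jn; apply/seteqP; split => w /=.
  move=> h; split; first by apply: (h j); rewrite /= leqnn.
  by move=> i /= /andP[ji ni]; apply: h; rewrite /= ni (ltnW ji).
move=> [h1 h2] i /= /andP[ji ni].
by move: ji; rewrite leq_eqVlt => /predU1P[<-//|ji]; apply: h2; rewrite /= ji.
Qed.

(** The induction on j carries all the future steps at once: independence of [Y j] from [xi j] alone
    would say nothing about [xi j.+1] once [Y j.+1] has consumed [xi j]. *)
Let rect j n := forall E (A : nat -> set RT), measurable E ->
  (forall i, measurable (A i)) ->
  P (Y j @^-1` E `&` future j n A) =
  (P (Y j @^-1` E) * \prod_(j <= i < n) gam i (A i))%E.

Let rect_product j n : (j < n)%N -> rect j n ->
  forall (A : nat -> set RT), (forall i, measurable (A i)) ->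
  forall F, measurable F ->
  P ((fun w => (Y j w, xi j w)) @^-1` F `&` future j.+1 n A) =
  ((distribution P (Y j) \x gam j) F * \prod_(j.+1 <= i < n) gam i (A i))%E.
Proof.
move=> jn rj A mA F mF.
have mf := mfuture j.+1 n mA.
pose m' : {measure set (U * RT) -> \bar R} :=
  measure_function_pushforward__canonical__measure_function_Measure (mrestr P mf)
    (chain_pair_measurable j).
have p0 : (0 <= \prod_(j.+1 <= i < n) gam i (A i))%E by apply: prode_ge0.
have pfin : (\prod_(j.+1 <= i < n) gam i (A i))%E \is a fin_num.
  by rewrite prode_fin_num// => i _; exact: fin_num_measure.
pose p := NngNum (fine_ge0 p0).
(* The probability of the remaining future is a constant factor; put into the measure, it lets
   uniqueness of product measures extend rectangles to any F. *)
pose m2 := mscale p (gam j).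
have := @product_measure_unique _ _ U RT R (distribution P (Y j)) m2 m'.
move=> /(_ _ F mF) h.
transitivity (m' F); first by [].
rewrite -h; last first.
  move=> E B mE mB; rewrite /m'/= /pushforward/= /mrestr /m2 /mscale/=.
  pose A' i := if i == j then B else A i.
  have mA' i : measurable (A' i) by rewrite /A'; case: ifP.
  have A'E i : (j < i)%N -> A' i = A i by move=> ji; rewrite /A' gtn_eqF.
  have -> : (fun w => (Y j w, xi j w)) @^-1` (E `*` B) `&` future j.+1 n A =
    Y j @^-1` E `&` future j n A'.
    rewrite (futureS A' jn) setIA; congr (_ `&` _).
      by rewrite /A' eqxx.
    apply: eq_bigcapr => i /= /andP[ji _]; by rewrite A'E.
  rewrite rj// (big_ltn jn) {1}/A' eqxx; congr (_ * _)%E.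
  rewrite muleC fineK//; congr (_ * _)%E.
  by apply: eq_big_nat => i /andP[ji _]; rewrite A'E.
rewrite -[LHS]/((\int[distribution P (Y j)]_x (m2 \o xsection F) x)%E).
rewrite /m2 /mscale/=.
rewrite ge0_integralZl//=; first by rewrite muleC fineK.
  exact: measurable_fun_xsection.
by rewrite fineK.
Qed.

Let rect_all j n : (j <= n)%N -> rect j n.
Proof.
elim: j => [_|j IH jn] E A mE mA.
  have -> : future 0 n A = \bigcap_(i in [set i | (i < n)%N]) (xi i @^-1` A i) by [].
  have [yE|yE] := pselect (E y0).
    have -> : Y 0 @^-1` E = setT by apply/seteqP; split => // w _; rewrite /= Y0.
    by rewrite setTI ind// probability_setT mul1e big_mkord.
  have -> : Y 0 @^-1` E = set0 by apply/seteqP; split => // w; rewrite /= Y0.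
  by rewrite set0I measure0 mul0e.
have rj := IH (ltnW jn).
have mPE : measurable (Phi j @^-1` E) by rewrite -[X in measurable X]setTI; exact: mPhi.
have YSE : Y j.+1 @^-1` E = (fun w => (Y j w, xi j w)) @^-1` (Phi j @^-1` E).
  by apply/seteqP; split => w /=; rewrite YS.
rewrite YSE (rect_product jn rj mA mPE); congr (_ * _)%E.
have := rect_product jn rj (fun=> measurableT) mPE.
rewrite (_ : future _ _ _ = setT) ?setIT; last by apply/seteqP; split.
by move=> ->; rewrite big1 ?mule1// => i _; rewrite probability_setT.
Qed.

Lemma chain_product j F : measurable F ->
  P ((fun w => (Y j w, xi j w)) @^-1` F) = (distribution P (Y j) \x gam j)%E F.
Proof.
move=> mF.
have := rect_product (ltnSn j) (rect_all (leqnSn j)) (fun=> measurableT) mF.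
rewrite (_ : future _ _ _ = setT) ?setIT; last by apply/seteqP; split.
by rewrite big_geq// mule1.
Qed.

Lemma ge0_integral_chain j (G : U * RT -> \bar R) :
  measurable_fun [set: U * RT] G -> (forall p, 0 <= G p)%E ->
  (\int[P]_w G (Y j w, xi j w) = \int[P]_w \int[gam j]_v G (Y j w, v))%E.
Proof.
move=> mG G0.
pose phi w := (Y j w, xi j w).
transitivity (\int[pushforward P phi]_z G z)%E.
  rewrite (@ge0_integral_pushforward _ _ T (U * RT)%type R phi
    (chain_pair_measurable j) P setT G measurableT mG (fun z _ => G0 z)).
  by [].
transitivity (\int[distribution P (Y j) \x gam j]_z G z)%E.
  apply: eq_measure_integral => [|mf A mA _]; first exact: chain_pair_measurable.
  exact: (chain_product j mA).
rewrite fubini_tonelli1//.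
rewrite ge0_integral_distribution//.
- exact: measurable_fun_fubini_tonelli_F.
- by move=> y; apply: integral_ge0.
Qed.

End Independence.

(** * The killed walk *)

Section Walk.
Context {R : realType} {d : measure_display} {T : measurableType d} {P : probability T R}.
Local Notation RT := (measurableTypeR R).
Variable W : R -> T -> R.
Hypothesis hW : std_brownian P W.
Variables x y e c s : R.
Hypotheses (x0 : 0 < x) (ey : 0 < e <= y) (c01 : 0 < c <= 1) (s01 : 0 < s <= 1).

Let y0 : 0 < y. Proof. by case/andP: ey => e0; exact: lt_le_trans. Qed.
Let e0 : 0 < e. Proof. by case/andP: ey. Qed.
Let s0 : 0 < s. Proof. by case/andP: s01. Qed.
Let c0 : 0 < c. Proof. by case/andP: c01. Qed.

Definition brownian_step (j : nat) (w : T) : RT := W (j.+1%:R * s ^+ 2) w - W (j%:R * s ^+ 2) w.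

(** With this rate the one-step decrease of the potential is ten times the exponent a. As u <= 5, u
    - 10 a <= u (1 - 2 a) <= u exp(-2 a), which more than pays for the factor exp(a). *)
Definition walk_rate : R := gauss_mass / (20 * y).

Definition walk_next (p : (R * R) * RT) : R * R :=
  if 0 < p.1.1 then (p.1.1 + p.2, p.1.2 * expR (walk_rate * s ^+ 2 * fpot e y p.1.1)) else p.1.

(* The walk is frozen once it leaves (0, oo); the second component is the exponential
   of its additive functional. *)
Fixpoint killed_walk (j : nat) (w : T) : R * R :=
  if j is i.+1 then walk_next (killed_walk i w, brownian_step i w) else (x, 1).

Let walk_rate_ge0 : 0 <= walk_rate.
Proof. by apply: divr_ge0; [exact: ltW gauss_mass_gt0|apply: mulr_ge0 => //; exact: ltW]. Qed.

Lemma measurable_brownian_step j : measurable_fun [set: T] (brownian_step j).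
Proof. by case: hW => mW _ _ _; exact: measurable_funB. Qed.

Lemma brownian_step_independent n (A : nat -> set RT) : (forall i, measurable (A i)) ->
  P (\bigcap_(i in [set i | (i < n)%N]) (brownian_step i @^-1` A i)) =
  (\prod_(i < n) normal_prob 0 s (A i))%E.
Proof.
move=> mA; case: hW => _ _ _ /(_ n (fun i => i%:R * s ^+ 2) A).
rewrite mul0r => /(_ erefl) -> //.
- apply: eq_bigr => i _; congr (normal_prob _ _ _).
  have -> : i.+1%:R * s ^+ 2 - i%:R * s ^+ 2 = s ^+ 2 by rewrite -mulrBl -natrB// subSnn mul1r.
  by rewrite sqrtr_sqr gtr0_norm.
- by move=> i _; rewrite ltr_pM2r ?exprn_gt0// ltr_nat.
- by move=> i _; exact: mA.
Qed.

Lemma measurable_walk_next : measurable_fun [set: (R * R) * RT] walk_next.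
Proof.
have m1 : measurable_fun [set: (R * R) * RT] (fun p => p.1.1 : R).
  by apply: (measurableT_comp measurable_fst); exact: measurable_fst.
have m2 : measurable_fun [set: (R * R) * RT] (fun p => p.1.2 : R).
  by apply: (measurableT_comp measurable_snd); exact: measurable_fst.
have m3 : measurable_fun [set: (R * R) * RT] (fun p => p.2 : R) by exact: measurable_snd.
apply: measurable_fun_ifT.
- by apply: measurable_fun_ltr.
- apply: measurable_fun_pair; first exact: measurable_funD.
  apply: measurable_funM => //; apply: measurableT_comp => //.
  apply: measurable_funM => //; apply: (measurableT_comp _ m1).
  exact: measurable_fpot.
- exact: measurable_fst.
Qed.

Let gam (_ : nat) : probability RT R := normal_prob 0 s.

Lemma measurable_killed_walk j : measurable_fun [set: T] (killed_walk j).
Proof.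
by apply: (@chain_measurable R d T _ (R * R)%type brownian_step measurable_brownian_step
   killed_walk (fun=> walk_next) (x, 1) (fun=> measurable_walk_next)).
Qed.

Lemma killed_walk2_gt0 j w : 0 < (killed_walk j w).2.
Proof.
elim: j => //= j IH; rewrite /walk_next/=; case: ifP => //= _.
by rewrite mulr_gt0// expR_gt0.
Qed.

(** The exponential bounds the growth factor of one step, since [fpot] is at most 1 / e and s <=
    1. *)
Definition walk_error : R := 129 * kpot e y c * expR (walk_rate / e).

Lemma walk_error_ge0 : 0 <= walk_error.
Proof. by apply: mulr_ge0; [apply: mulr_ge0 => //; exact: kpot_ge0|exact: expR_ge0]. Qed.

Lemma walk_one_step (p : R * R) : 0 <= p.2 ->
  (\int[normal_prob 0 s]_v ((walk_next (p, v)).2 * upot e y c (walk_next (p, v)).1)%:E <=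
   (((1 + walk_error * s ^+ 3) * (p.2 * upot e y c p.1))%:E))%E.
Proof.
case: p => z q /= q0; rewrite /walk_next/=.
have u1 := upot_ge1 e y c z.
have s3 : 0 <= walk_error * s ^+ 3 by rewrite mulr_ge0 ?walk_error_ge0 ?exprn_ge0 ?ltW.
have [z0|z0] := ltP 0 z; last first.
  rewrite integral_cst//= probability_setT mule1 lee_fin.
  by rewrite ler_peMl ?mulr_ge0 ?(le_trans _ u1)// lerDl.
set a := walk_rate * s ^+ 2 * fpot e y z.
have a0 : 0 <= a by apply: mulr_ge0; [apply: mulr_ge0; [exact: walk_rate_ge0|exact: sqr_ge0]|exact: fpot_ge0].
have h := @normal_prob_step R s (upot e y c) z (fpot e y z / (2 * y)) (kpot e y c) s01
  (measurable_upot e y c).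
have {}h := h (fun v => le_trans ler01 (upot_ge1 e y c v)).
have {}h := h (divr_ge0 (fpot_ge0 e y z) (mulr_ge0 (ler0n R 2) (ltW y0))) (kpot_ge0 c e0 y0)
 (fun v => upot_second_difference v e0 y0 c0 (ltW z0)).
have mup : measurable_fun [set: R] (fun v => upot e y c (z + v)).
  by apply: (measurableT_comp (measurable_upot e y c)); exact: measurable_funD.
under eq_integral do rewrite EFinM.
rewrite ge0_integralZl_EFin//=; last 3 first.
- by move=> v _; rewrite lee_fin (le_trans _ (upot_ge1 _ _ _ _)).
- by apply/measurable_EFinP.
- by rewrite mulr_ge0// expR_ge0.
apply: (@le_trans _ _ ((q * expR a)%:E * (upot e y c z - fpot e y z / (2 * y) * gauss_mass * s ^+ 2 +
        129 * kpot e y c * s ^+ 3)%:E)%E).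
  by rewrite lee_wpmul2l// lee_fin mulr_ge0// expR_ge0.
rewrite -EFinM lee_fin -(mulrA q) (mulrCA _ q); apply: ler_wpM2l => //.
have -> : fpot e y z / (2 * y) * gauss_mass * s ^+ 2 = 10 * a.
  by rewrite /a /walk_rate; field; rewrite gt_eqF.
set u := upot e y c z.
have u5 : u <= 5 by apply: upot_le5 => //; case/andP: c01 => ? ->; rewrite ltW.
have hu : u - 10 * a <= u * expR (- (2 * a)).
  apply: le_trans (_ : u * (1 - 2 * a) <= _); first by nra.
  by rewrite ler_wpM2l ?(le_trans _ u1)// (le_trans _ (expR_ge1Dx _)).
have ea : expR a <= expR (walk_rate / e).
  rewrite ler_expR /a -mulrA ler_wpM2l//.
  apply: le_trans (_ : 1 * e^-1 <= _); last by rewrite mul1r.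
  rewrite ler_pM ?sqr_ge0 ?fpot_ge0 ?fpot_le//.
  by rewrite exprn_ile1 ?(ltW s0)//; case/andP: s01.
have k0 : 0 <= 129 * kpot e y c * s ^+ 3.
  by rewrite mulr_ge0 ?exprn_ge0 ?(ltW s0)// mulr_ge0// kpot_ge0.
apply: le_trans (_ : expR a * (u * expR (- (2 * a)) + 129 * kpot e y c * s ^+ 3) <= _).
  by rewrite ler_wpM2l ?expR_ge0// lerD2r.
rewrite [leLHS]mulrDr (mulrCA _ u) -expRD [leRHS]mulrDl mul1r lerD//.
  have a2 : expR (a - 2 * a) <= 1 by rewrite -[leRHS]expR0 ler_expR; lra.
  by apply: ler_piMr => //; apply: le_trans u1.
apply: le_trans (_ : walk_error * s ^+ 3 <= _).
  have -> : walk_error * s ^+ 3 = expR (walk_rate / e) * (129 * kpot e y c * s ^+ 3) by rewrite /walk_error; ring.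
  exact: ler_wpM2r.
exact: ler_peMr.
Qed.

Let ub (p : R * R) : \bar R := (p.2 * upot e y c p.1)%:E.

Let mub : measurable_fun [set: R * R] ub.
Proof.
apply/measurable_EFinP; apply: measurable_funM; first exact: measurable_snd.
by apply: (measurableT_comp (measurable_upot e y c)); exact: measurable_fst.
Qed.

Lemma killed_walk_expectation j :
  (\int[P]_w ((killed_walk j w).2 * upot e y c (killed_walk j w).1)%:E <=
   ((1 + walk_error * s ^+ 3) ^+ j * upot e y c x)%:E)%E.
Proof.
have k0 : 0 <= 1 + walk_error * s ^+ 3.
  by rewrite addr_ge0// mulr_ge0 ?walk_error_ge0 ?exprn_ge0 ?ltW.
elim: j => [|j IH] /=.
  by rewrite integral_cst//= probability_setT mule1 !mul1r.
(* The absolute value makes the integrand nonnegative at every state; along the walk the second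
   component is positive, so nothing changes. *)
pose G (p : (R * R) * RT) : \bar R := (`|(walk_next p).2| * upot e y c (walk_next p).1)%:E.
have mG : measurable_fun [set: (R * R) * RT] G.
  apply/measurable_EFinP; apply: measurable_funM.
    apply: measurableT_comp => //; apply: (measurableT_comp measurable_snd).
    exact: measurable_walk_next.
  apply: (measurableT_comp (measurable_upot e y c)).
  apply: (measurableT_comp measurable_fst); exact: measurable_walk_next.
have G0 p : (0 <= G p)%E.
  by rewrite lee_fin mulr_ge0// (le_trans _ (upot_ge1 _ _ _ _)).
have next0 p v : 0 <= p.2 -> 0 <= (walk_next (p, v)).2.
  by move=> p0; rewrite /walk_next; case: ifP => //= _; rewrite mulr_ge0// expR_ge0.
have := @ge0_integral_chain R d T P _ (R * R)%type brownian_step gam measurable_brownian_step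
  brownian_step_independent killed_walk (fun=> walk_next) (x, 1) (fun=> measurable_walk_next)
  (fun=> erefl) (fun _ _ => erefl) j G mG G0.
rewrite /G => eqG.
under eq_integral => w _.
  rewrite -[X in (X * _)%:E]ger0_norm; last first.
    by apply: next0; rewrite ltW// killed_walk2_gt0.
  over.
rewrite eqG.
apply: (@le_trans _ _ (\int[P]_w ((1 + walk_error * s ^+ 3)%:E * ub (killed_walk j w)))%E).
  apply: ge0_le_integral => //.
  - by move=> w _; apply: integral_ge0 => v _; exact: G0.
  - apply: (@measurableT_comp _ _ _ _ _ _ (fun p => \int[gam j]_v G (p, v))%E _ _ _ (measurable_killed_walk j)).
    exact: (@measurable_fun_fubini_tonelli_F _ _ (R * R)%type RT R (gam 0) G).
  - apply: emeasurable_funM => //.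
    exact: (measurableT_comp mub (measurable_killed_walk j)).
  - move=> w _; rewrite /ub -EFinM.
    apply: le_trans (walk_one_step _); last by rewrite ltW// killed_walk2_gt0.
    rewrite le_eqVlt; apply/orP; left; apply/eqP; apply: eq_integral => v _.
    by rewrite ger0_norm// next0// ltW// killed_walk2_gt0.
rewrite ge0_integralZl_EFin//; last 2 first.
- move=> w _; rewrite lee_fin mulr_ge0 ?(ltW (killed_walk2_gt0 _ _))//.
  by rewrite (le_trans _ (upot_ge1 _ _ _ _)).
- exact: (measurableT_comp mub (measurable_killed_walk j)).
have -> : (1 + walk_error * s ^+ 3) ^+ j.+1 * upot e y c x = (1 + walk_error * s ^+ 3) * ((1 + walk_error * s ^+ 3) ^+ j * upot e y c x) by rewrite exprS mulrA.
by rewrite [leRHS]EFinM; apply: lee_wpmul2l; rewrite ?lee_fin.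
Qed.

Lemma killed_walk2_expectation j :
  (\int[P]_w ((killed_walk j w).2)%:E <= (expR (walk_error * s ^+ 3 *+ j) * upot e y c x)%:E)%E.
Proof.
apply: le_trans (_ : ((1 + walk_error * s ^+ 3) ^+ j * upot e y c x)%:E <= _)%E; last first.
  rewrite lee_fin ler_wpM2r ?(le_trans _ (upot_ge1 _ _ _ _))//.
  rewrite -mulr_natr expRM_natr lerXn2r// ?nnegrE ?expR_ge0// ?expR_ge1Dx//.
  by rewrite addr_ge0// mulr_ge0 ?walk_error_ge0 ?exprn_ge0 ?ltW.
apply: le_trans (killed_walk_expectation j).
apply: ge0_le_integral => //.
- by move=> w _; rewrite lee_fin ltW// killed_walk2_gt0.
- apply/measurable_EFinP; apply: (measurableT_comp measurable_snd).
  exact: measurable_killed_walk.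
- exact: (measurableT_comp mub (measurable_killed_walk j)).
- by move=> w _; rewrite lee_fin ler_peMr ?(ltW (killed_walk2_gt0 _ _))// upot_ge1.
Qed.

Lemma killed_walk_alive w j : (forall i, (i < j)%N -> 0 < x + W (i%:R * s ^+ 2) w) ->
  (killed_walk j w).1 = x + W (j%:R * s ^+ 2) w /\
  (killed_walk j w).2 =
    expR (walk_rate * s ^+ 2 * \sum_(i < j) fpot e y (x + W (i%:R * s ^+ 2) w)).
Proof.
elim: j => [_|j IH h] /=.
  by rewrite mul0r big_ord0 mulr0 expR0; case: hW => _ -> _ _; rewrite addr0.
have [E1 E2] := IH (fun i ij => h i (ltnW ij)).
rewrite /walk_next/= E1 h// E2/= /brownian_step; split; first by rewrite addrA addrAC addrC -!addrA; ring.
by rewrite big_ord_recr/= mulrDr expRD.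
Qed.

Lemma killed_walk2_nondecreasing w i j : (i <= j)%N -> (killed_walk i w).2 <= (killed_walk j w).2.
Proof.
move=> /subnK <-; elim: (j - i)%N => // k IH; apply: (le_trans IH); rewrite addSn /=.
rewrite /walk_next/=; case: ifP => //= _.
rewrite ler_peMr ?(ltW (killed_walk2_gt0 _ _))// -expR0 ler_expR.
by apply: mulr_ge0; [apply: mulr_ge0; [exact: walk_rate_ge0|exact: sqr_ge0]|exact: fpot_ge0].
Qed.

End Walk.

(** * Continuous paths and local times *)

Section ContinuousWithin.
Context {R : realType}.

Lemma continuous_within_dist (V : pseudoMetricType R) (A : set V) (f : V -> R) (x : V) :
  {within A, continuous f} -> A x -> forall eta, 0 < eta ->
  exists2 del : R, 0 < del & forall z, ball x del z -> A z -> `|f x - f z| < eta.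
Proof.
move=> hf Ax eta eta0.
have /cvgrPdist_lt/(_ _ eta0) h := hf x.
have /(nbhs_subspace_ex _ Ax)[B /nbhs_ballP[del /= del0 xB] UB] := h.
exists del => // z bz Az.
by have [] : ([set t | `|f x - f t| < eta] `&` A) z by rewrite UB; split => //; exact: xB.
Qed.

Lemma path_continuous_dist (f : R -> R) (u : R) :
  {within `[0, +oo[, continuous f} -> 0 <= u -> forall eta, 0 < eta ->
  exists2 del : R, 0 < del & forall z, 0 <= z -> `|u - z| < del -> `|f u - f z| < eta.
Proof.
move=> hf u0 eta eta0.
have [|del del0 h] := continuous_within_dist hf (x := u) _ eta0.
  by rewrite /= in_itv/= u0.
by exists del => // z z0 uz; apply: h => //=; rewrite in_itv/= z0.
Qed.

(** Freezing the path at negative times turns continuity on [0, oo) into the continuity everywhere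
    that [measurable_caratheodory] asks for. *)
Lemma continuous_max0 (f : R -> R) :
  {within `[0, +oo[, continuous f} -> continuous (fun u : R => f (Num.max 0 u)).
Proof.
move=> hf u; apply/cvgrPdist_lt => eta eta0.
have u0 : 0 <= Num.max 0 u by rewrite le_max lexx.
have [del del0 h] := path_continuous_dist hf u0 eta0.
apply/nbhs_ballP; exists del => //= z; rewrite /ball/= => uz.
apply: h; first by rewrite le_max lexx.
apply: le_lt_trans uz.
rewrite ler_norml.
have := ler_norm (u - z); have := ler_norm (z - u); rewrite distrC => h1 h2.
by case: (leP 0 u) => ?; case: (leP 0 z) => ?; apply/andP; split; lra.
Qed.

Lemma uniform_continuous_segment (f : R -> R) (r eta : R) :
  {within `[0, +oo[, continuous f} -> 0 < eta ->
  exists2 del : R, 0 < del & forall u v, 0 <= u <= r -> 0 <= v ->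
    `|u - v| < del -> `|f u - f v| < eta.
Proof.
move=> hf eta0.
have /compact_near_coveringP := @segment_compact R 0 r.
pose Q (del u : R) := 0 <= u -> forall v, 0 <= v -> `|u - v| < del -> `|f u - f v| < eta.
move=> /(_ _ (0 : R)^'+ Q _) hQ.
have {hQ} : \forall del \near (0 : R)^'+, `[0, r]%classic `<=` Q del.
  apply: hQ => u /=; rewrite in_itv/= => /andP[u0 ur].
  have [del del0 h] := path_continuous_dist hf u0 (divr_gt0 eta0 (ltr0n _ 2)).
  have d2 : 0 < del / 2 by rewrite divr_gt0.
  exists (ball u (del / 2), [set i | i < del / 2]) => /=.
    by split; [exact: nbhsx_ballx|exact: nbhs_right_lt].
  move=> [u' i] /= [uu' id2] u'0 v v0 u'v.
  have h1 : `|f u - f u'| < eta / 2.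
    by apply: h => //; apply: lt_trans uu' _; lra.
  have h2 : `|f u - f v| < eta / 2.
    apply: h => //; have := ler_distD u' u v; move: uu'; rewrite /ball/=; lra.
  by have := ler_distD (f u) (f u') (f v); rewrite (distrC (f u') (f u)); lra.
move=> near1.
have /filter_ex[del [del0 h]] : \forall del \near (0 : R)^'+, 0 < del /\ `[0, r]%classic `<=` Q del.
  by apply: filterI => //; exact: nbhs_right_gt.
exists del => // u v /andP[u0 ur] v0 uv; apply: (h u) => //=.
by rewrite in_itv/= u0.
Qed.

End ContinuousWithin.

(** * Local time at a fixed level as a limit of occupation ratios *)

Section LocalTime.
Context {R : realType}.
Variables (b : R -> R) (l : R -> R -> R).
Local Notation mu := (@lebesgue_measure R).
Hypothesis hb : {within `[0, +oo[, continuous b}.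
Hypothesis l0 : forall y s, 0 <= l y s.
Hypothesis lc : {within [set p : R * R | 0 <= p.2], continuous (fun p : R * R => l p.1 p.2)}.
Hypothesis occupation : forall s, 0 <= s -> forall A : set R, measurable A ->
  mu (`[0, s]%classic `&` [set u | A (b u)]) = (\int[mu]_(y in A) (l y s)%:E)%E.

Lemma path_measurable : measurable_fun (`[0, +oo[%classic : set R) b.
Proof. by apply: subspace_continuous_measurable_fun. Qed.

Lemma occupied_measurable s (A : set R) : measurable A ->
  measurable (`[0, s]%classic `&` [set u | A (b u)]).
Proof.
move=> mA.
have -> : `[0, s]%classic `&` [set u | A (b u)] =
    `[0, s]%classic `&` (`[0, +oo[%classic `&` b @^-1` A).
  apply/seteqP; split => u /=; rewrite !in_itv/= ?andbT; last by move=> [? []].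
  by move=> [/andP[u0 us] Au]; rewrite u0 us.
by apply: measurableI => //; exact: path_measurable.
Qed.

Lemma local_time_dist y s eta : 0 <= s -> 0 < eta ->
  exists2 del : R, 0 < del & forall z, `|y - z| < del -> `|l y s - l z s| < eta.
Proof.
move=> s0 eta0.
have [|del del0 h] := continuous_within_dist lc (x := (y, s)) _ eta0; first by [].
by exists del => // z yz; apply: (h (z, s)) => //; split => //=; exact: ballxx.
Qed.

Lemma local_time_continuous s : 0 <= s -> continuous (fun y : R => l y s).
Proof.
move=> s0 y; apply/cvgrPdist_lt => eta eta0.
have [del del0 h] := local_time_dist y s0 eta0.
by apply/nbhs_ballP; exists del => //= z; exact: h.
Qed.

Lemma local_time_measurable s : 0 <= s -> measurable_fun [set: R] (fun y : R => l y s).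
Proof. by move=> s0; apply: continuous_measurable_fun; exact: local_time_continuous. Qed.

Definition occ (y s e : R) : \bar R := mu (`[0, s]%classic `&` [set u | `|b u - y| <= e]).

Lemma occE y s e : occ y s e = mu (`[0, s]%classic `&` [set u | `[y - e, y + e]%classic (b u)]).
Proof.
congr (mu (_ `&` _)); apply/seteqP; split => u /=.
  by rewrite in_itv/= ler_norml => /andP[? ?]; apply/andP; split; lra.
by rewrite in_itv/= ler_norml => /andP[? ?]; apply/andP; split; lra.
Qed.

Lemma occ_measurable y s e : measurable (`[0, s]%classic `&` [set u | `|b u - y| <= e]).
Proof.
have := @occupied_measurable s `[y - e, y + e]%classic (measurable_itv _).
congr measurable; congr (_ `&` _); apply/seteqP; split => u /=.
  by rewrite in_itv/= ler_norml => /andP[? ?]; apply/andP; split; lra.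
by rewrite in_itv/= ler_norml => /andP[? ?]; apply/andP; split; lra.
Qed.

(** Local time is known only through continuity and the occupation formula, so its values at a
    single level are read off from windows: [l y s] is the limit of [occ y s e / (2 * e)]. *)
Lemma occ_near y s eta : 0 <= s -> 0 < eta ->
  exists2 e0 : R, 0 < e0 & forall e, 0 < e < e0 ->
    ((2 * e * (l y s - eta))%:E <= occ y s e <= (2 * e * (l y s + eta))%:E)%E.
Proof.
move=> s0 eta0.
have [del del0 h] := local_time_dist y s0 eta0.
exists del => // e /andP[e0 ed]; rewrite occE occupation//.
have ml : measurable_fun (`[y - e, y + e]%classic : set R) (EFin \o (fun z => l z s)).
  by apply/measurable_EFinP; apply: measurable_funTS; exact: local_time_measurable.
have lE : mu `[y - e, y + e]%classic = (2 * e)%:E.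
  rewrite lebesgue_measure_itv/= lte_fin; case: ifPn => [_|]; last by rewrite -leNgt => ?; exfalso; lra.
  by rewrite -EFinB; congr EFin; ring.
have hz z : (`[y - e, y + e]%classic : set R) z -> l y s - eta < l z s < l y s + eta.
  rewrite /= in_itv/= => /andP[z1 z2].
  have : `|y - z| < del by rewrite ltr_norml; apply/andP; split; lra.
  by move/h; rewrite ltr_norml => /andP[? ?]; apply/andP; split; lra.
apply/andP; split.
  have [neg|pos] := leP (l y s - eta) 0.
    apply: (@le_trans _ _ 0%E); last by apply: integral_ge0 => z _; rewrite lee_fin.
    by rewrite lee_fin mulr_ge0_le0// mulr_ge0// ltW.
  apply: (@le_trans _ _ (\int[mu]_(z in `[(y - e)%R, (y + e)%R]%classic) (l y s - eta)%:E)%E).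
    by rewrite integral_cst//= lE -EFinM mulrC.
  apply: ge0_le_integral => //=.
  - by move=> z _; rewrite lee_fin ltW.
  - by move=> z /hz; rewrite lee_fin => /andP[/ltW].
apply: (@le_trans _ _ (\int[mu]_(z in `[(y - e)%R, (y + e)%R]%classic) (l y s + eta)%:E)%E).
  apply: ge0_le_integral => //=.
  - by move=> z _; rewrite lee_fin.
  - by move=> z /hz; rewrite lee_fin => /andP[_ /ltW].
by rewrite integral_cst//= lE -EFinM mulrC.
Qed.

Lemma local_time_le y s s' : 0 <= s -> 0 <= s' ->
  (exists2 e1 : R, 0 < e1 & forall e, 0 < e < e1 -> (occ y s e <= occ y s' e)%E) ->
  l y s <= l y s'.
Proof.
move=> s0 s'0 [e1 e10 h]; rewrite leNgt; apply/negP => lt.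
pose eta := (l y s - l y s') / 3.
have eta0 : 0 < eta by rewrite divr_gt0// subr_gt0.
have [e2 e20 h2] := occ_near y s0 eta0; have [e3 e30 h3] := occ_near y s'0 eta0.
pose e := Num.min e1 (Num.min e2 e3) / 2.
have m0 : 0 < Num.min e1 (Num.min e2 e3) by rewrite !lt_min e10 e20.
have e0 : 0 < e by rewrite divr_gt0.
have ee : e < Num.min e1 (Num.min e2 e3) by rewrite /e; lra.
move: ee; rewrite !lt_min => /and3P[ee1 ee2 ee3].
have /andP[+ _] := h2 e (introT andP (conj e0 ee2)).
have /andP[_ +] := h3 e (introT andP (conj e0 ee3)).
have := h e (introT andP (conj e0 ee1)) => h1 h4 h5.
have := le_trans h5 (le_trans h1 h4).
by rewrite lee_fin ler_pM2l ?mulr_gt0// /eta; lra.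
Qed.

Lemma local_time_nondecreasing y s s' : 0 <= s -> s <= s' -> l y s <= l y s'.
Proof.
move=> s0 ss'; apply: local_time_le => //; first exact: le_trans ss'.
exists 1 => // e _; apply: le_measure; rewrite ?inE; try exact: occ_measurable.
apply: setSI => u /=; rewrite !in_itv/= => /andP[-> us] /=; exact: le_trans ss'.
Qed.

Lemma local_time_constant y s s' e1 : 0 <= s -> s <= s' -> 0 < e1 ->
  (forall u, s <= u <= s' -> e1 < `|b u - y|) -> l y s' = l y s.
Proof.
move=> s0 ss' e10 h; apply/eqP; rewrite eq_le (local_time_nondecreasing y s0 ss') andbT.
apply: local_time_le => //; first exact: le_trans ss'.
exists e1 => // e /andP[e0 ee1]; apply: le_measure; rewrite ?inE; try exact: occ_measurable.
move=> u [] /=; rewrite !in_itv/= => /andP[u0 us'] ue; split => //.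
rewrite u0/= leNgt; apply/negP => su.
by have := h u; rewrite (ltW su) us' => /(_ isT); rewrite ltNge (le_trans ue)// ltW.
Qed.

(** Otherwise no level above a gains local time, and the occupation time of ]a, +oo[ up to s' is at
    most that up to s; but the path spends s' - s more there. *)
Lemma local_time_increases a s s' : 0 <= s -> s < s' ->
  (forall u, s <= u <= s' -> a < b u) -> exists2 y, a < y & l y s < l y s'.
Proof.
move=> s0 ss' h; apply: contrapT => no.
have le y : a < y -> l y s' <= l y s.
  by move=> ay; rewrite leNgt; apply/negP => lt; apply: no; exists y.
have s'0 : 0 <= s' by rewrite ltW// (le_lt_trans s0).
have := occupation s'0 (measurable_itv `]a, +oo[); have := occupation s0 (measurable_itv `]a, +oo[).
set A := (X in mu X = _ -> _) => EA; set B := (X in mu X = _) => EB.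
have mA : measurable A by apply: occupied_measurable; exact: measurable_itv.
have mB : measurable B by apply: occupied_measurable; exact: measurable_itv.
have BA : (mu B <= mu A)%E.
  rewrite EA EB; apply: ge0_le_integral => //=.
  - by move=> y _; rewrite lee_fin.
  - by apply/measurable_EFinP; apply: measurable_funTS; exact: local_time_measurable.
  - by apply/measurable_EFinP; apply: measurable_funTS; exact: local_time_measurable.
  - by move=> y; rewrite in_itv/= andbT lee_fin; exact: le.
have Afin : (mu A < +oo)%E.
  apply: (@le_lt_trans _ _ (mu `[0, s]%classic)).
    by apply: le_measure; rewrite ?inE//; exact: subIsetl.
  by rewrite lebesgue_measure_itv/=; case: ifP => // _; rewrite ltry.
have : (mu A + mu `]s, s']%classic <= mu B)%E.
  rewrite -measureU//.
  - apply: le_measure; rewrite ?inE//; first exact: measurableU.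
    move=> u [[]|] /=; rewrite /B /= !in_itv/= ?andbT.
      by move=> /andP[-> us] ->; rewrite (le_trans us)// ltW.
    by move=> /andP[su us']; rewrite us' h ?(ltW su) ?us'//= (le_trans s0)// ltW.
  - apply/seteqP; split => // u [[] /=]; rewrite !in_itv/= => /andP[_ us] _ /andP[su _].
    by move: su; rewrite ltNge us.
have -> : mu `]s, s']%classic = (s' - s)%:E.
  by rewrite lebesgue_measure_itv/= lte_fin ss' -EFinB.
move=> AB; have {AB BA} := le_trans AB BA.
have : (0 <= mu A)%E by exact: measure_ge0.
move: Afin; case: (mu A) => // r _ _; rewrite -EFinD lee_fin; lra.
Qed.

End LocalTime.

(** * Absorption time and lifetime *)

Section NonnegRationals.
Context {R : realType}.

(** The default 0 and the absolute value make every index legitimate in this enumeration of the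
    nonnegative rationals. *)
Definition nnrat (n : nat) : R := `|ratr (odflt 0%Q (unpickle n))|.

Lemma nnrat_ge0 n : 0 <= nnrat n. Proof. exact: normr_ge0. Qed.

Lemma nnrat_dense (a b : R) : 0 <= a -> a < b -> exists n, a < nnrat n < b.
Proof.
move=> a0 ab; have [r] := rat_in_itvoo ab; rewrite in_itv/= => /andP[ar rb].
exists (pickle r); rewrite /nnrat pickleK/= ger0_norm ?ar//.
by rewrite ltW// (le_lt_trans a0).
Qed.

End NonnegRationals.

(** * The time change at the end of the lifetime *)

Section Absorption.
Context {R : realType} {d : measure_display} {T : measurableType d}.
Variables (W : R -> T -> R) (L : R -> R -> T -> R) (m : {measure set R -> \bar R}) (x : R).

Definition alive (r : R) (w : T) : Prop := forall u, 0 <= u <= r -> 0 < x + W u w.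

(* The additive functional at the hitting time of 0, as a countable supremum for
   the sake of measurability. *)
Definition lifetime (w : T) : \bar R :=
  ereal_sup (range (fun n => if `[< alive (nnrat n) w >] then add_fun W L m x (nnrat n) w else 0%E)).

Variable w : T.
Hypotheses (x0 : 0 < x) (W0 : W 0 w = 0).
Hypothesis hW : {within `[0, +oo[, continuous (fun s => W s w)}.
Hypothesis l0 : forall y s, 0 <= L y s w.
Hypothesis lc : {within [set p : R * R | 0 <= p.2], continuous (fun p : R * R => L p.1 p.2 w)}.
Hypothesis occupation : forall s, 0 <= s -> forall A : set R, measurable A ->
  lebesgue_measure (`[0, s]%classic `&` [set u | A (W u w)]) =
  (\int[lebesgue_measure]_(y in A) (L y s w)%:E)%E.
Hypothesis hm : speed_measure m.

Let l y s := L y s w.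
Let A s := add_fun W L m x s w.
Let pos : set R := [set y : R | 0 < y].

Let mpos : measurable pos.
Proof.
have -> : pos = `]0, +oo[%classic by apply/seteqP; split => y /=; rewrite in_itv/= andbT.
exact: measurable_itv.
Qed.

Let l_measurable s : 0 <= s -> measurable_fun pos (fun y : R => (L (y - x) s w)%:E).
Proof.
move=> s0; apply/measurable_EFinP; apply: measurable_funTS.
have ml := @local_time_measurable R l lc s s0.
by apply: (measurableT_comp ml); exact: measurable_funB.
Qed.

Lemma add_fun_ge0 s : (0 <= A s)%E.
Proof. by apply: integral_ge0 => y _; rewrite lee_fin. Qed.

Lemma add_fun_nondecreasing s s' : 0 <= s -> s <= s' -> (A s <= A s')%E.
Proof.
move=> s0 ss'; apply: ge0_le_integral => //.
- by move=> y _; rewrite lee_fin.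
- exact: l_measurable.
- by apply: l_measurable; exact: le_trans ss'.
- move=> y _; rewrite lee_fin.
  exact: (@local_time_nondecreasing _ (fun u => W u w) (fun y s => L y s w)).
Qed.

Lemma add_fun_constant s s' : 0 <= s -> s <= s' ->
  (forall u, s <= u <= s' -> x + W u w < 0) -> A s' = A s.
Proof.
move=> s0 ss' h; apply: eq_integral => y; rewrite inE/= => y0; congr EFin.
apply: (@local_time_constant R (fun u => W u w) l hW l0 lc occupation (y - x) s s' (y / 2)) => //.
  by rewrite divr_gt0.
move=> u /h hu; rewrite distrC; apply: lt_le_trans (ler_norm _); lra.
Qed.

(** Some level gains local time; by continuity a whole interval of positive levels does, and m
    charges it. Finiteness of [A s] makes the inequality strict. *)
Lemma add_fun_increases s s' : 0 <= s -> s < s' ->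
  (forall u, s <= u <= s' -> 0 < x + W u w) -> (A s < +oo)%E -> (A s < A s')%E.
Proof.
move=> s0 ss' h fin.
have s'0 : 0 <= s' by rewrite ltW// (le_lt_trans s0).
have [|y xy ll] := @local_time_increases _ (fun u => W u w) l hW l0 lc occupation (- x) s s' s0 ss'.
  by move=> u /h; lra.
(* A third of the gain: near y each of the two local times moves by less than k, which leaves at
   least k. *)
pose k := (L y s' w - L y s w) / 3.
have k0 : 0 < k by rewrite divr_gt0// subr_gt0.
have kE : 3 * k = L y s' w - L y s w by rewrite /k mulrC divfK.
have [d1 d10 h1] := @local_time_dist R l lc y s k s0 k0.
have [d2 d20 h2] := @local_time_dist R l lc y s' k s'0 k0.
(* The bound y + x keeps the interval J inside (0, oo). *)
pose dl := Num.min (Num.min d1 d2) (y + x).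
have dl0 : 0 < dl by rewrite !lt_min d10 d20/=; lra.
pose J := `](y + x - dl), (y + x + dl)[%classic : set R.
have mJ : measurable J by exact: measurable_itv.
have Jpos z : J z -> 0 < z.
  rewrite /J/= in_itv/= => /andP[+ _].
  have : dl <= y + x by rewrite ge_min lexx orbT.
  by lra.
have Jl z : J z -> L (z - x) s w + k <= L (z - x) s' w.
  rewrite /J/= in_itv/= => /andP[z1 z2].
  have zd : `|y - (z - x)| < dl by rewrite ltr_norml; apply/andP; split; lra.
  have : `|y - (z - x)| < d1 by apply: lt_le_trans zd _; rewrite !ge_min lexx.
  move/h1; rewrite /l ltr_norml => /andP[? ?].
  have : `|y - (z - x)| < d2 by apply: lt_le_trans zd _; rewrite !ge_min lexx orbT.
  move/h2; rewrite /l ltr_norml => /andP[? ?].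
  by lra.
have mJ0 : (0 < m J)%E.
  case: hm => _ _; apply; last by lra.
  have : dl <= y + x by rewrite ge_min lexx orbT.
  by lra.
have : (A s + k%:E * m J <= A s')%E.
  have -> : (k%:E * m J)%E = (\int[m]_(z in pos) (k * \1_J z)%:E)%E.
    under eq_integral do rewrite EFinM.
    rewrite ge0_integralZl_EFin ?(ltW k0)//; last first.
      by apply/measurable_EFinP; exact: measurable_indic.
    rewrite integral_indic//; congr (_ * m _)%E; apply/esym/setIidPl => z; exact: Jpos.
  rewrite /A /add_fun -ge0_integralD//; last 4 first.
  - by move=> z _; rewrite lee_fin.
  - exact: l_measurable.
  - by move=> z _; rewrite lee_fin mulr_ge0// ltW.
  - by apply/measurable_EFinP; apply: measurable_funM => //; exact: measurable_indic.
  apply: ge0_le_integral => //.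
  - by move=> z _; rewrite -EFinD lee_fin addr_ge0// mulr_ge0// ltW.
  - apply: emeasurable_funD; first exact: l_measurable.
    by apply/measurable_EFinP; apply: measurable_funM => //; exact: measurable_indic.
  - exact: l_measurable.
  - move=> z _; rewrite -EFinD lee_fin indicE; case: (boolP (z \in J)) => zJ.
      by rewrite mulr1 Jl// -inE.
    rewrite mulr0 addr0.
    exact: (@local_time_nondecreasing _ (fun u => W u w) (fun y s => L y s w)) (ltW ss').
apply: lt_le_trans.
by rewrite lteDl ?mule_gt0 ?lte_fin// ge0_fin_numE// add_fun_ge0.
Qed.

Lemma alive_dead r s : alive r w -> 0 <= s -> x + W s w <= 0 -> r < s.
Proof. by move=> h s0 ws; rewrite ltNge; apply/negP => sr; have := h s; rewrite s0 sr => /(_ isT); lra. Qed.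

Lemma lifetime_ge0 : (0 <= lifetime w)%E.
Proof.
apply: le_trans (ereal_sup_ubound _); last by exists 0%N.
by case: asboolP => // _; exact: add_fun_ge0.
Qed.

Lemma lifetime_ge n : alive (nnrat n) w -> (A (nnrat n) <= lifetime w)%E.
Proof. by move=> al; apply: ereal_sup_ubound; exists n => //; case: asboolP. Qed.

Lemma lifetime_le (t : \bar R) : (0 <= t)%E -> (forall n, alive (nnrat n) w -> (A (nnrat n) <= t)%E) ->
  (lifetime w <= t)%E.
Proof.
move=> t0 h; apply: ge_ereal_sup => _ [n _ <-].
by case: asboolP => // /h.
Qed.

Lemma lifetime_le_add_fun s : 0 <= s -> x + W s w <= 0 -> (lifetime w <= A s)%E.
Proof.
move=> s0 ws; apply: lifetime_le => [|n al]; first exact: add_fun_ge0.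
by apply: add_fun_nondecreasing; [exact: nnrat_ge0|rewrite ltW// alive_dead].
Qed.

Let path_dist u : 0 <= u -> forall eta, 0 < eta ->
  exists2 del : R, 0 < del & forall z, 0 <= z -> `|u - z| < del -> `|W u w - W z w| < eta.
Proof. exact: (path_continuous_dist hW). Qed.

Lemma time_change_fin t : 0 <= t -> time_change W L m x t w \is a fin_num ->
  exists2 s, 0 <= s & (t%:E < A s)%E.
Proof.
move=> t0 fin; apply: contrapT => no.
move: fin; rewrite /time_change (_ : [set _ | _ in _] = set0) ?ereal_inf0//.
by apply/seteqP; split => // _ [s [s0 ts] <-]; apply: no; exists s.
Qed.

Lemma time_change_ge0 t : (0 <= time_change W L m x t w)%E.
Proof. by apply: le_ereal_inf_tmp => _ [s [s0 _] <-]; rewrite lee_fin. Qed.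

(** The time change s at u sits at a zero of the path, hence after every alive time; were A above u
    at an alive time, the infimum defining s would be smaller. *)
Lemma X_at_zero_lifetime u : 0 <= u -> X_at_zero W L m x u w ->
  (lifetime w <= u%:E)%E /\ (exists2 s, 0 <= s & x + W s w <= 0) /\
  (exists2 s, 0 <= s & (u%:E < A s)%E).
Proof.
move=> u0 [fin]; have tc0 := time_change_ge0 u.
set s := fine _ => xs.
have s0 : 0 <= s by exact: fine_ge0.
have sE : time_change W L m x u w = s%:E by rewrite fineK.
split; last first.
  by split; [exists s => //; rewrite xs|exact: time_change_fin].
apply: lifetime_le => [|n al]; first by rewrite lee_fin.
have ns : nnrat n < s by apply: alive_dead al _ _; rewrite ?xs.
rewrite leNgt; apply/negP => un.
have : (time_change W L m x u w <= (nnrat n)%:E)%E.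
  by apply: ereal_inf_lbound; exists (nnrat n) => //; split => //; exact: nnrat_ge0.
by rewrite sE lee_fin leNgt ns.
Qed.

(** At the time change s of u, A is at most u before s and above u after it. A negative position
    would make A constant around s. A positive one would either prolong life past s, so that the
    lifetime exceeds u, or, if the path has already been at or below 0, make A increase strictly
    just before s although it has already reached u. *)
Lemma X_at_zero_at_lifetime u : lifetime w = u%:E ->
  (exists2 s, 0 <= s & x + W s w <= 0) ->
  (exists2 s, 0 <= s & (u%:E < A s)%E) -> X_at_zero W L m x u w.
Proof.
move=> Tu [s1 s10 ws1] [s2 s20 us2].
have tc0 := time_change_ge0 u.
have fin : time_change W L m x u w \is a fin_num.
  rewrite ge0_fin_numE//; apply: (@le_lt_trans _ _ s2%:E); last by rewrite ltry.
  by apply: ereal_inf_lbound; exists s2.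
split => //; set s := fine _.
have s0 : 0 <= s by exact: fine_ge0.
have sE : time_change W L m x u w = s%:E by rewrite fineK.
have before z : 0 <= z -> z < s -> (A z <= u%:E)%E.
  move=> z0 zs; rewrite leNgt; apply/negP => uz.
  have : (time_change W L m x u w <= z%:E)%E by apply: ereal_inf_lbound; exists z.
  by rewrite sE lee_fin leNgt zs.
have after z : s < z -> (u%:E < A z)%E.
  move=> sz; have : (time_change W L m x u w < z%:E)%E by rewrite sE lte_fin.
  move=> /ereal_inf_lt[_ [z' [z'0 uz'] <-]]; rewrite lte_fin => z'z.
  by apply: (lt_le_trans uz'); apply: add_fun_nondecreasing => //; exact: ltW.
have [neg|posi|//] := ltgtP (x + W s w) 0.
- exfalso.
  have negN : 0 < - (x + W s w) by lra.
  have [del del0 h] := path_dist s0 negN.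
  have hneg z : 0 <= z -> `|s - z| < del -> x + W z w < 0.
    by move=> z0 /(h _ z0); rewrite ltr_norml => /andP[? ?]; lra.
  have spos : 0 < s.
    by rewrite lt_neqAle s0 andbT eq_sym; apply/eqP => sz; move: neg; rewrite sz W0 addr0 ltNge (ltW x0).
  pose z := Num.max 0 (s - del / 2).
  have z0 : 0 <= z by rewrite le_max lexx.
  have zs : z < s by rewrite gt_max spos/=; lra.
  have zd : s - del / 2 <= z by rewrite le_max lexx orbT.
  have : A (s + del / 2) = A z.
    apply: add_fun_constant => //; first by lra.
    move=> v /andP[zv vs]; apply: hneg; first exact: le_trans zv.
    by rewrite ltr_norml; apply/andP; split; lra.
  have sd : s < s + del / 2 by lra.
  by move=> AE; have := after _ sd; rewrite AE ltNge before.
- exfalso.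
  have [del del0 h] := path_dist s0 posi.
  have hpos z : 0 <= z -> `|s - z| < del -> 0 < x + W z w.
    by move=> z0 /(h _ z0); rewrite ltr_norml => /andP[? ?]; lra.
  have [al|] := pselect (alive s w).
    have ssd : s < s + del by lra.
    have [n /andP[sn nd]] := nnrat_dense s0 ssd.
    have aln : alive (nnrat n) w.
      move=> v /andP[v0 vn]; have [vs|sv] := leP v s; first by apply: al; rewrite v0.
      by apply: hpos => //; rewrite ltr_norml; apply/andP; split; lra.
    by have := lifetime_ge aln; rewrite Tu leNgt after.
  move=> /existsNP[s3 /not_implyP[/andP[s30 s3s] /negP]]; rewrite -leNgt => ws3.
  have s3d : s3 <= s - del.
    rewrite leNgt; apply/negP => lt; have := hpos s3 s30.
    rewrite ger0_norm ?subr_ge0// => /(_ _)/wrap[]; first by lra.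
    by lra.
  have z10 : 0 <= s - del / 2 by lra.
  have : (A (s - del / 2) < A (s - del / 4))%E.
    apply: add_fun_increases => //; first by lra.
    - move=> v /andP[v1 v2]; apply: hpos; first by lra.
      by rewrite ltr_norml; apply/andP; split; lra.
    - by apply: (@le_lt_trans _ _ u%:E); [apply: before => //; lra|rewrite ltry].
  rewrite ltNge; apply/negP; rewrite negbK.
  apply: (@le_trans _ _ u%:E); first by apply: before; lra.
  rewrite -Tu; apply: (le_trans (lifetime_le_add_fun s30 ws3)).
  by apply: add_fun_nondecreasing => //; lra.
Qed.

(** The last condition keeps the time change finite at the lifetime: it is the infimum of the times
    at which A is strictly above that value. *)
Lemma absorption_time_leP t : (absorption_time W L m x w <= t%:E)%E <->
  [/\ (lifetime w <= t%:E)%E, exists2 s, 0 <= s & x + W s w <= 0 &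
      exists2 s, 0 <= s & (lifetime w < A s)%E].
Proof.
split=> [le|[le h1 h2]].
  have : (absorption_time W L m x w < +oo)%E by rewrite (le_lt_trans le)// ltry.
  move=> /ereal_inf_lt[_ [u [u0 /(X_at_zero_lifetime u0)[Tu [h1 [s s0 us]]]] <-]] _.
  split => //; last by exists s => //; exact: le_lt_trans us.
  apply: le_trans le; apply: le_ereal_inf_tmp => _ [v [v0 Xv] <-].
  by have [] := X_at_zero_lifetime v0 Xv.
have fin : lifetime w \is a fin_num.
  by rewrite ge0_fin_numE ?lifetime_ge0// (le_lt_trans le)// ltry.
have TE : lifetime w = (fine (lifetime w))%:E by rewrite fineK.
apply: le_trans le; rewrite TE; apply: ereal_inf_lbound.
exists (fine (lifetime w)) => //; split; first by rewrite fine_ge0// lifetime_ge0.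
by apply: X_at_zero_at_lifetime => //; rewrite -TE.
Qed.

End Absorption.

Lemma near_invS_lt (R : realType) (eta : R) : 0 < eta -> \forall k \near \oo, k.+1%:R^-1 < eta.
Proof. by move=> eta0; exact: (near_infty_natSinv_lt (PosNum eta0)). Qed.

(** * Measurability *)

Section JointMeasurability.
Context {R : realType} {d dX : measure_display} {T : measurableType d} {X : measurableType dX}.

(** [U] is replaced by its grid value of mesh 1 / (k + 1), so that only countably many of the
    measurable functions [phi u] occur; continuity in u then gives the limit. *)
Lemma measurable_caratheodory (phi : R -> T -> R) (U : X -> R) (V : X -> T) :
  (forall w, continuous (fun u : R => phi u w)) -> (forall u, measurable_fun [set: T] (phi u)) ->
  measurable_fun [set: X] U -> measurable_fun [set: X] V ->
  measurable_fun [set: X] (fun z => phi (U z) (V z)).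
Proof.
move=> cphi mphi mU mV.
pose g (k : nat) z : R := (Num.floor (k.+1%:R * U z))%:~R / k.+1%:R.
apply: (@measurable_fun_cvg _ _ _ _ (fun k z => phi (g k z) (V z))).
- move=> k _ Y mY; rewrite setTI.
  pose B (j : int) : set X := (fun z => k.+1%:R * U z) @^-1` `[j%:~R, j%:~R + 1[%classic `&`
       ((phi (j%:~R / k.+1%:R) \o V) @^-1` Y).
  have -> : (fun z => phi (g k z) (V z)) @^-1` Y = \bigcup_j B j.
    apply/seteqP; split => z /=.
      move=> Yz; exists (Num.floor (k.+1%:R * U z)) => //; split => //=.
      rewrite in_itv/= floor_le_tmp/=.
      by have := floorD1_gt (k.+1%:R * U z); rewrite intrD.
    move=> [j _ [/= + Yz]]; rewrite in_itv/= => /andP[j1 j2].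
    rewrite /g (_ : Num.floor _ = j)//; apply: floor_def.
    by rewrite j1 intrD.
  apply: countable_bigcupT_measurable; first exact: countableP.
  move=> j; apply: measurableI.
    have m1 : measurable_fun [set: X] (fun z => k.+1%:R * U z) by exact: measurable_funM.
    by rewrite -[X in measurable X]setTI; apply: m1 => //; exact: measurable_itv.
  have m1 : measurable_fun [set: X] (phi (j%:~R / k.+1%:R) \o V) by exact: measurableT_comp.
  by rewrite -[X in measurable X]setTI; exact: m1.
- move=> z _.
  have gU : g k z @[k --> \oo] --> U z.
    apply/cvgrPdist_le => eta eta0; near=> k.
    have k0 : 0 < k.+1%:R :> R by [].
    have h1 : (Num.floor (k.+1%:R * U z))%:~R <= k.+1%:R * U z by exact: floor_le_tmp.
    have h2 : k.+1%:R * U z < (Num.floor (k.+1%:R * U z))%:~R + 1.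
      by have := floorD1_gt (k.+1%:R * U z); rewrite intrD.
    have h3 : k.+1%:R^-1 < eta by near: k; exact: near_invS_lt.
    have -> : U z - g k z = (k.+1%:R * U z - (Num.floor (k.+1%:R * U z))%:~R) / k.+1%:R.
      by rewrite /g; field; rewrite addrC natr1 gt_eqF.
    rewrite ger0_norm; last by rewrite divr_ge0// subr_ge0.
    by apply: le_trans (ltW h3); rewrite ler_pdivrMr// mulVf ?gt_eqF//; lra.
  exact: (cvg_comp _ _ gU (cphi (V z) (U z))).
Unshelve. all: by end_near. Qed.

End JointMeasurability.

(** * Measurability of the lifetime and of the absorption time *)

Section BrownianMeasurability.
Context {R : realType} {d : measure_display} {T : measurableType d}.
Local Notation RT := (measurableTypeR R).
Local Notation mu := (@lebesgue_measure R).
Variables (W : R -> T -> R) (L : R -> R -> T -> R) (m : {measure set R -> \bar R}) (x : R).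
Hypothesis mW : forall t, measurable_fun [set: T] (W t).
Hypothesis W0 : forall w, W 0 w = 0.
Hypothesis cW : forall w, {within `[0, +oo[, continuous (fun s => W s w)}.
Hypothesis hL : local_time W L.
Hypothesis hm : speed_measure m.
Hypothesis x0 : 0 < x.

Let l0 w y s : 0 <= L y s w. Proof. by case: (hL w). Qed.
Let lc w : {within [set p : R * R | 0 <= p.2], continuous (fun p : R * R => L p.1 p.2 w)}.
Proof. by case: (hL w). Qed.
Let occupation w s : 0 <= s -> forall A : set R, measurable A ->
  mu (`[0, s]%classic `&` [set u | A (W u w)]) = (\int[mu]_(y in A) (L y s w)%:E)%E.
Proof. by case: (hL w) => _ _; apply. Qed.

Lemma measurable_occ y s e : measurable_fun [set: T] (fun w => occ (fun u => W u w) y s e).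
Proof.
pose A : set (T * RT) := (fun p => p.2) @^-1` `[0, s]%classic `&`
   (fun p => W (Num.max 0 p.2) p.1) @^-1` `[y - e, y + e]%classic.
have mA : measurable A.
  apply: measurableI.
    have m2 : measurable_fun [set: T * RT] snd by exact: measurable_snd.
    by rewrite -[X in measurable X]setTI; apply: m2 => //; exact: measurable_itv.
  have m2 : measurable_fun [set: T * RT] (fun p => W (Num.max 0 p.2) p.1).
    apply: (@measurable_caratheodory R d _ T (T * RT)%type (fun u w => W (Num.max 0 u) w) snd fst) => //.
    by move=> w; apply: (continuous_max0 (@cW w)).
  by rewrite -[X in measurable X]setTI; apply: m2 => //; exact: measurable_itv.
rewrite (_ : (fun w => _) = (mu : set RT -> \bar R) \o xsection A); first exact: measurable_fun_xsection.
apply/funext => w /=; rewrite occE; congr (mu _); apply/seteqP; split => u.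
  move=> [us uy]; apply/xsectionP; split => //=.
  by move: us; rewrite /= in_itv/= => /andP[u0 _]; rewrite max_r.
move=> /xsectionP[/= us uy]; split => //=.
by move: us uy; rewrite /= in_itv/= => /andP[u0 _]; rewrite max_r.
Qed.

(** Measurability in w is inherited from the occupation ratios, which are measures of sections of a
    jointly measurable set. *)
Lemma measurable_local_time y s : 0 <= s -> measurable_fun [set: T] (L y s).
Proof.
move=> s0.
apply: (@measurable_fun_cvg _ _ _ _ (fun n w => fine (occ (fun u => W u w) y s n.+1%:R^-1) / (2 * n.+1%:R^-1))).
  move=> n; apply: measurable_funM => //.
  by apply: (measurableT_comp _ (measurable_occ y s _)); exact: fine_measurable.
move=> w _; apply/cvgrPdist_le => eta eta0.
have [e0 e00 h] := @occ_near R (fun u => W u w) (fun y s => L y s w) (@l0 w) (@lc w) (@occupation w) y s eta s0 eta0.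
near=> n.
have n0 : 0 < n.+1%:R^-1 :> R by rewrite invr_gt0.
have ne : n.+1%:R^-1 < e0 by near: n; exact: near_invS_lt.
have /andP[] := h n.+1%:R^-1 (introT andP (conj n0 ne)).
set o := occ _ _ _ _; case: o => [r| |]//=; rewrite !lee_fin => h1 h2.
have n2 : 0 < 2 * n.+1%:R^-1 :> R by rewrite mulr_gt0.
have {}h1 : L y s w - eta <= r / (2 * n.+1%:R^-1) by rewrite ler_pdivlMr// mulrC.
have {}h2 : r / (2 * n.+1%:R^-1) <= L y s w + eta by rewrite ler_pdivrMr// mulrC.
by rewrite ler_norml; apply/andP; split; lra.
Unshelve. all: by end_near. Qed.

Lemma measurable_local_time_pair s : 0 <= s ->
  measurable_fun [set: R * T] (fun p => L (p.1 - x) s p.2).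
Proof.
move=> s0.
apply: (@measurable_caratheodory R d _ T (R * T)%type (fun u w => L u s w) (fun p => p.1 - x) snd) => //.
- by move=> w; exact: (@local_time_continuous R (fun y s => L y s w) (@lc w) s s0).
- by move=> u; exact: measurable_local_time.
- by apply: measurable_funB => //; exact: measurable_fst.
Qed.

(* The unused argument is what attaches a sigma-finite structure to m. *)
Definition sigma_speed (hm0 : speed_measure m) : set R -> \bar R := m.

Let sigma_speed0 : sigma_speed hm set0 = 0%E. Proof. exact: measure0. Qed.
Let sigma_speed_ge0 A : (0 <= sigma_speed hm A)%E. Proof. exact: measure_ge0. Qed.
Let sigma_speed_additive : semi_sigma_additive (sigma_speed hm).
Proof. exact: measure_semi_sigma_additive. Qed.

HB.instance Definition _ := isMeasure.Build _ _ _ (sigma_speed hm)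
  sigma_speed0 sigma_speed_ge0 sigma_speed_additive.

Let sigma_speed_sigma_finite : sigma_finite setT (sigma_speed hm).
Proof.
have [m0 mfin _] := hm.
exists (fun n => `]-oo, 0]%classic `|` `[n.+1%:R^-1, n.+1%:R]%classic).
  apply/seteqP; split => // y _.
  have [y0|y0] := leP y 0; first by exists 0%N => //; left; rewrite /= in_itv.
  pose n := Num.truncn (y + y^-1).
  exists n => //; right; rewrite /= in_itv/=.
  have yy : y + y^-1 < n.+1%:R by exact: truncnS_gt.
  have yi : 0 < y^-1 by rewrite invr_gt0.
  apply/andP; split; last by lra.
  by rewrite -[leRHS]invrK lef_pV2 ?posrE//; lra.
move=> n; split; first by apply: measurableU; exact: measurable_itv.
apply: (@le_lt_trans _ _ (m `]-oo, 0%R]%classic + m `[(n.+1%:R^-1)%R, (n.+1%:R)%R]%classic)%E).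
  by apply: measureU2; exact: measurable_itv.
rewrite m0 add0e; apply: mfin; first by rewrite invr_gt0.
by rewrite (@le_trans _ _ 1)// ?invf_le1// ler1n.
Qed.

HB.instance Definition _ := Measure_isSigmaFinite.Build _ _ _ (sigma_speed hm)
  sigma_speed_sigma_finite.

Lemma tonelli_speed (P : {sigma_finite_measure set T -> \bar R}) (f : R * T -> \bar R) :
  measurable_fun [set: R * T] f -> (forall p, 0 <= f p)%E ->
  (\int[P]_w \int[m]_y f (y, w) = \int[m]_y \int[P]_w f (y, w))%E.
Proof.
move=> mf f0.
by rewrite (@fubini_tonelli _ _ R T R (sigma_speed hm) P f mf f0).
Qed.

Lemma measurable_integral_speed (f : R * T -> \bar R) :
  measurable_fun [set: R * T] f -> (forall p, 0 <= f p)%E ->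
  measurable_fun [set: T] (fun w => \int[m]_y f (y, w))%E.
Proof.
move=> mf f0.
have h := @measurable_fun_fubini_tonelli_G _ _ R T R (sigma_speed hm) f mf f0.
exact h.
Qed.

Definition positive_local_time s (p : R * T) : \bar R :=
  if 0 < p.1 then (L (p.1 - x) s p.2)%:E else 0%E.

Lemma positive_local_time_ge0 s p : (0 <= positive_local_time s p)%E.
Proof. by rewrite /positive_local_time; case: ifP => // _; rewrite lee_fin. Qed.

Lemma measurable_positive_local_time s : 0 <= s ->
  measurable_fun [set: R * T] (positive_local_time s).
Proof.
move=> s0; apply: measurable_fun_ifT => //.
- by apply: measurable_fun_ltr => //; exact: measurable_fst.
- by apply/measurable_EFinP; exact: measurable_local_time_pair.
Qed.

Lemma add_funE s w : add_fun W L m x s w = (\int[m]_y positive_local_time s (y, w))%E.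
Proof.
rewrite /add_fun integral_mkcond; apply: eq_integral => y _.
rewrite patchE /positive_local_time/=.
by case: ifPn => [|]; [rewrite inE/= => ->|move=> /negP; rewrite inE/=; case: ifP].
Qed.

Lemma measurable_add_fun s : 0 <= s -> measurable_fun [set: T] (add_fun W L m x s).
Proof.
move=> s0; rewrite (_ : add_fun _ _ _ _ _ = (fun w => \int[m]_y positive_local_time s (y, w))%E).
  apply: measurable_integral_speed; first exact: measurable_positive_local_time.
  exact: positive_local_time_ge0.
by apply/funext => w; exact: add_funE.
Qed.

(** Positivity at rational times does not exclude a zero at an irrational one; a uniform margin
    does, and the minimum of the path on [0, r] provides it. *)
Lemma aliveP r w : 0 <= r -> alive W x r w <->
  exists k : nat, forall n, nnrat n <= r -> k.+1%:R^-1 <= x + W (nnrat n) w.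
Proof.
move=> r0; split.
  move=> al; have cb : {within `[0, r], continuous (fun s => W s w)}.
    by apply: continuous_subspaceW (@cW w) => u /=; rewrite !in_itv/= => /andP[->].
  have [c] := EVT_min r0 cb; rewrite in_itv/= => /al wc h.
  pose k := Num.truncn (x + W c w)^-1.
  exists k => n nr; apply: (@le_trans _ _ (x + W c w)).
    rewrite -[leRHS]invrK lef_pV2 ?posrE ?invr_gt0//.
    by apply: ltW; exact: truncnS_gt.
  by rewrite lerD2l h// in_itv/= nnrat_ge0.
move=> [k h] u /andP[u0 ur].
have k0 : 0 < k.+1%:R^-1 :> R by rewrite invr_gt0.
have [del del0 hd] := path_continuous_dist (@cW w) u0 k0.
(* Density needs an interval of positive length; at r = 0 the path is at x. *)
have [r00|rpos] := eqVneq r 0.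
  have -> : u = 0 by apply/eqP; rewrite eq_le u0 andbT -r00.
  by rewrite W0 addr0.
have rp : 0 < r by rewrite lt_neqAle eq_sym rpos.
have [n /andP[n1 n2]] : exists n, Num.max 0 (u - del) < nnrat n < Num.min r (u + del).
  apply: nnrat_dense; first by rewrite le_max lexx.
  by rewrite gt_max !lt_min rp/=; apply/and3P; split; lra.
move: n1 n2; rewrite gt_max lt_min => /andP[_ n1] /andP[n2 n3].
have un : `|u - nnrat n| < del by rewrite ltr_norml; apply/andP; split; lra.
have := hd (nnrat n) (nnrat_ge0 n) un; rewrite ltr_norml => /andP[lo _].
have lem (K a b : R) : - K < a - b -> K <= x + b -> 0 < x + a by lra.
exact: lem lo (h n (ltW n2)).
Qed.

Lemma measurable_alive r : 0 <= r -> measurable [set w | alive W x r w].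
Proof.
move=> r0.
have -> : [set w | alive W x r w] = \bigcup_k \bigcap_(n in [set n | nnrat n <= r])
   (fun w => x + W (nnrat n) w) @^-1` `[k.+1%:R^-1, +oo[%classic.
  apply/seteqP; split => w /=.
    move=> /(aliveP _ r0)[k h]; exists k => // n /= nr; rewrite in_itv/= andbT; exact: h.
  move=> [k _ h]; apply/(aliveP _ r0); exists k => n nr.
  by have := h n nr; rewrite /= in_itv/= andbT.
apply: bigcupT_measurable => k; apply: bigcap_measurableType => n _.
have m1 : measurable_fun [set: T] (fun w => x + W (nnrat n) w) by exact: measurable_funD.
by rewrite -[X in measurable X]setTI; apply: m1 => //; exact: measurable_itv.
Qed.

Lemma measurable_if_alive dX (X : measurableType dX) (V : X -> T) r (f : X -> \bar R) : 0 <= r ->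
  measurable_fun [set: X] V -> measurable_fun [set: X] f ->
  measurable_fun [set: X] (fun z => if `[< alive W x r (V z) >] then f z else 0%E).
Proof.
move=> r0 mV mf; apply: measurable_fun_ifT => //.
apply: (@measurable_fun_bool _ _ _ _ true); rewrite setTI.
rewrite (_ : _ @^-1` _ = V @^-1` [set w | alive W x r w]).
  by rewrite -[X in measurable X]setTI; apply: mV => //; exact: measurable_alive.
by apply/seteqP; split => z /= /asboolP.
Qed.

Lemma measurable_ereal_sup_range dX (X : measurableType dX) (f : nat -> X -> \bar R) :
  (forall n, measurable_fun [set: X] (f n)) ->
  measurable_fun [set: X] (fun z => ereal_sup (range (f ^~ z))).
Proof.
move=> mf; rewrite (_ : (fun z => _) = (fun z => esups (f ^~ z) 0%N)).
  exact: measurable_fun_esups.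
apply/funext => z; rewrite /esups; congr ereal_sup; apply/seteqP; split => _ [n ? <-]; by exists n.
Qed.

Lemma measurable_lifetime : measurable_fun [set: T] (lifetime W L m x).
Proof.
apply: measurable_ereal_sup_range => n; apply: (measurable_if_alive (V := id)) => //.
- exact: nnrat_ge0.
- exact: measurable_add_fun (nnrat_ge0 n).
Qed.

Lemma absorption_time_le_set t : [set w | (absorption_time W L m x w <= t%:E)%E] =
  [set w | (lifetime W L m x w <= t%:E)%E] `&`
  (\bigcup_(n : nat) ~` [set w | alive W x n%:R w]) `&`
  (\bigcup_(n : nat) [set w | (lifetime W L m x w < add_fun W L m x n%:R w)%E]).
Proof.
apply/seteqP; split => w /=.
  move=> /(absorption_time_leP x0 (W0 w) (@cW w) (@l0 w) (@lc w) (@occupation w) hm) [h1 [s s0 ws] [s' s'0 ls]].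
  split; first split => //.
    exists (Num.truncn s).+1 => // al.
    have := al s; rewrite s0 ltW ?truncnS_gt// => /(_ isT).
    by rewrite ltNge ws.
  exists (Num.truncn s').+1 => //=; apply: (lt_le_trans ls).
  apply: add_fun_nondecreasing => //; last by rewrite ltW ?truncnS_gt.
  exact: (@occupation w).
move=> [[h1 [n _ h2]] [n' _ h3]].
apply/(absorption_time_leP x0 (W0 w) (@cW w) (@l0 w) (@lc w) (@occupation w) hm); split => //.
  move: h2 => /existsNP[s /not_implyP[/andP[s0 _] /negP]]; rewrite -leNgt => ws.
  by exists s.
by exists n'%:R.
Qed.

Lemma measurable_absorption_time t : measurable [set w | (t%:E < absorption_time W L m x w)%E].
Proof.
have -> : [set w | (t%:E < absorption_time W L m x w)%E] =
    ~` [set w | (absorption_time W L m x w <= t%:E)%E].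
  by apply/seteqP; split => w /=; [move=> h; rewrite leNgt h|move=> /negP; rewrite -ltNge].
apply: measurableC; rewrite absorption_time_le_set; apply: measurableI; first apply: measurableI.
- rewrite -[X in measurable X]setTI; apply: emeasurable_fun_infty_c => //; exact: measurable_lifetime.
- apply: bigcupT_measurable => n; apply: measurableC; exact: measurable_alive.
- apply: bigcupT_measurable => n; rewrite -[X in measurable X]setTI.
  apply: measurable_lte => //; first exact: measurable_lifetime.
  exact: measurable_add_fun.
Qed.

End BrownianMeasurability.

(** * Exponential moments of the local time *)

Section LimInf.
Context {R : realType}.

Lemma limn_einfE (u : (\bar R)^nat) : limn_einf u = ereal_sup (range (einfs u)).
Proof. by rewrite limn_einf_lim; apply/cvg_lim => //; exact: cvg_einfs_sup. Qed.

Lemma limn_einf_ge (u : (\bar R)^nat) b : (\forall n \near \oo, (b <= u n)%E) -> (b <= limn_einf u)%E.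
Proof.
move=> [N _ h]; rewrite limn_einfE.
apply: le_trans (ereal_sup_ubound _); last by exists N.
by apply: le_ereal_inf_tmp => _ [k /= Nk <-]; exact: h.
Qed.

Lemma limn_einf_le (u : (\bar R)^nat) b : (\forall n \near \oo, (u n <= b)%E) -> (limn_einf u <= b)%E.
Proof.
move=> [N _ h]; rewrite limn_einfE; apply: ge_ereal_sup => _ [n _ <-].
apply: (@le_trans _ _ (u (maxn n N))); last by apply: h; rewrite /= leq_maxr.
by apply: ereal_inf_lbound; exists (maxn n N) => //=; rewrite leq_maxl.
Qed.

Lemma measurable_fun_limn_einf d (X : measurableType d) (f : (X -> \bar R)^nat) :
  (forall n, measurable_fun [set: X] (f n)) ->
  measurable_fun [set: X] (fun z => limn_einf (f ^~ z)).
Proof.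
move=> mf; rewrite (_ : (fun z => _) = (fun z => ereal_sup (range ((fun n z => einfs (f ^~ z) n) ^~ z)))).
  by apply: measurable_ereal_sup_range => n; exact: measurable_fun_einfs.
by apply/funext => z; rewrite limn_einfE.
Qed.

End LimInf.

Section LocalTimeMoment.
Context {R : realType} {d : measure_display} {T : measurableType d} {P : probability T R}.
Local Notation mu := (@lebesgue_measure R).
Variables (W : R -> T -> R) (L : R -> R -> T -> R).
Hypothesis hW : std_brownian P W.
Hypothesis hL : local_time W L.
Variables x y : R.
Hypotheses (x0 : 0 < x) (y0 : 0 < y).

Let cW w : {within `[0, +oo[, continuous (fun s => W s w)}.
Proof. by case: hW. Qed.

(** The step variance is (n + 1)^-4, so (n + 1)^5 steps cover the time n + 1, which tends to
    infinity, while the errors [mesh n ^+ 3] add up to 1 / (n + 1), which tends to 0. *)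
Definition mesh (n : nat) : R := n.+1%:R ^- 2.
Definition horizon (n : nat) : nat := (n.+1 ^ 5)%N.

Let mesh_gt0 n : 0 < mesh n. Proof. by rewrite invr_gt0 exprn_gt0. Qed.

Let mesh01 n : 0 < mesh n <= 1.
Proof. by rewrite mesh_gt0 invf_le1 ?exprn_gt0// exprn_ege1// ler1n. Qed.

Let mesh2 n : mesh n ^+ 2 = n.+1%:R ^- 4.
Proof. by rewrite /mesh -exprVn -exprM exprVn. Qed.

Let walk_rate_ge0 : 0 <= walk_rate y.
Proof. by apply: divr_ge0; [exact: ltW gauss_mass_gt0|apply: mulr_ge0 => //; exact: ltW]. Qed.

Definition walk_functional e n w : R := (killed_walk W x y e (mesh n) (horizon n) w).2.

(** For a fine mesh, all the time spent within e of y - x lies in grid cells whose left end is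
    within 2 e of it, and each such cell contributes at least its length over 27 e to the Riemann
    sum of [fpot]. *)
Lemma walk_functional_lower e w r : 0 < e <= y -> 0 <= r -> alive W x r w ->
  \forall n \near \oo, expR (walk_rate y * (fine (occ (fun u => W u w) (y - x) r e) / (27 * e))) <=
     walk_functional e n w.
Proof.
move=> ey r0 al; have /andP[e0 _] := ey.
have [del del0 hd] := uniform_continuous_segment r (@cW w) e0.
near=> n.
set dl := mesh n ^+ 2.
have dl0 : 0 < dl by rewrite exprn_gt0.
have dle : dl < del.
  apply: (@le_lt_trans _ _ n.+1%:R^-1); last by near: n; exact: near_invS_lt.
  rewrite /dl mesh2 lef_pV2 ?posrE ?exprn_gt0//.
  by rewrite -[leLHS]expr1 ler_weXn2l// ler1n.
have rn : r < n.+1%:R.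
  near: n; exists (Num.truncn r) => // k /= rk.
  by apply: lt_le_trans (truncnS_gt r) _; rewrite ler_nat ltnS.
(* The left ends i dl with i < M are at most r, so the walk is alive there; after M the functional
   can only grow. *)
pose M := (Num.truncn (r / dl)).+1.
have MN : (M <= horizon n)%N.
  rewrite /M -(ltr_nat R); apply: le_lt_trans (_ : r / dl < _).
    by rewrite truncn_le// divr_ge0// ltW.
  rewrite /dl mesh2 invrK /horizon natrX [X in _ < X]exprS ltr_pM2r// exprn_gt0//.
have iM i : (i < M)%N -> i%:R * dl <= r.
  rewrite /M ltnS => iM; rewrite -ler_pdivlMr//.
  by apply: le_trans (_ : (Num.truncn (r / dl))%:R <= _); rewrite ?ler_nat// truncn_le// divr_ge0// ltW.
have aliveM i : (i < M)%N -> 0 < x + W (i%:R * dl) w.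
  by move=> /iM ir; apply: al; rewrite ir mulr_ge0// ltW.
have [_ E2] := killed_walk_alive hW y e (s := mesh n) aliveM.
apply: le_trans (killed_walk2_nondecreasing W x (mesh n) ey w MN).
rewrite E2 -/dl ler_expR -mulrA ler_wpM2l// ler_pdivrMr ?mulr_gt0//.
pose C i : bool := `|W (i%:R * dl) w - (y - x)| <= 2 * e.
pose A i : set R := if C i then `[i%:R * dl, i.+1%:R * dl]%classic else set0.
have mA i : measurable (A i) by rewrite /A; case: ifP.
have sub : `[0, r]%classic `&` [set u | `|W u w - (y - x)| <= e] `<=` \big[setU/set0]_(i < M) A i.
  move=> u [/=]; rewrite in_itv/= => /andP[u0 ur] ue.
  pose i := Num.truncn (u / dl).
  have udl : 0 <= u / dl by rewrite divr_ge0// ltW.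
  have i1 : i%:R * dl <= u by rewrite -ler_pdivlMr// truncn_le.
  have i2 : u < i.+1%:R * dl by rewrite -ltr_pdivrMr// truncnS_gt.
  have ii : (i < M)%N.
    rewrite /M -(ltr_nat R); apply: le_lt_trans (truncnS_gt _).
    by apply: (@le_trans _ _ (u / dl)); [by rewrite truncn_le|rewrite ler_pM2r ?invr_gt0].
  rewrite -bigcup_mkord; exists i => //=; rewrite /A ifT.
    by rewrite /= in_itv/= i1 ltW.
  have wd : `|W (i%:R * dl) w - W u w| < e.
    apply: hd => //; first by rewrite mulr_ge0 ?(ltW dl0)//= (le_trans i1).
    rewrite ler0_norm ?subr_le0//; move: i2; rewrite -natr1 mulrDl mul1r; lra.
  by rewrite /C; have := ler_distD (W u w) (W (i%:R * dl) w) (y - x); lra.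
have : (occ (fun u => W u w) (y - x) r e <=
   (27 * e * (dl * \sum_(i < M) fpot e y (x + W (i%:R * dl) w)))%:E)%E.
  apply: (@le_trans _ _ (mu (\big[setU/set0]_(i < M) A i))).
    apply: le_measure => //; rewrite inE; first exact: (occ_measurable (@cW w)).
    by apply: bigsetU_measurable => i _; exact: mA.
  apply: le_trans (@Boole_inequality _ R (measurableTypeR R) mu A M (fun i _ => mA i)) _.
  rewrite mulr_sumr mulr_sumr -sumEFin; apply: lee_sum => i _.
  rewrite /A; case: ifPn => [Ci|_]; last first.
    rewrite measure0 lee_fin; apply: mulr_ge0; first by rewrite mulr_ge0// ltW.
    by apply: mulr_ge0; [exact: ltW|exact: fpot_ge0].
  have lE : mu `[(i%:R * dl)%R, (i.+1%:R * dl)%R]%classic = dl%:E.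
    rewrite lebesgue_measure_itv/= lte_fin ltr_pM2r// ltr_nat ltnSn -EFinB -mulrBl -natrB//.
    by rewrite subSnn mul1r.
  apply: (@le_trans _ _ dl%:E); first by rewrite -lE.
  rewrite lee_fin mulrCA ler_peMr ?(ltW dl0)//.
  rewrite -ler_pdivrMl ?mulr_gt0// mulr1.
  apply: fpot_ge => //; move: Ci; rewrite /C.
  by rewrite (_ : W _ w - (y - x) = x + W (i%:R * dl) w - y)//; ring.
have : (0 <= occ (fun u => W u w) (y - x) r e)%E by exact: measure_ge0.
case: (occ _ _ _ _) => // o _; rewrite lee_fin /= => h.
by rewrite [leRHS]mulrC.
Unshelve. all: by end_near. Qed.

(** At most 1 so that [upot] stays below 5; at most x / y so that the starting value is within 1 + x
    / y + 2 x / y. *)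
Let cc : R := Num.min 1 (x / y).

Let cc01 : 0 < cc <= 1.
Proof. by rewrite lt_min ltr01 divr_gt0//= ge_min lexx. Qed.

Lemma walk_functional_measurable e n : 0 < e <= y ->
  measurable_fun [set: T] (fun w => (walk_functional e n w)%:E).
Proof.
move=> ey; apply/measurable_EFinP; apply: (measurableT_comp measurable_snd).
exact: (measurable_killed_walk hW).
Qed.

Lemma walk_functional_expectation e : 0 < e <= y ->
  (limn_einf (fun n => \int[P]_w (walk_functional e n w)%:E) <= (1 + 3 * (x / y))%:E)%E.
Proof.
move=> ey; have /andP[e0 _] := ey; have /andP[c0 c1] := cc01.
have u3 : upot e y cc x <= 1 + 3 * (x / y).
  apply: le_trans (upot_le e y0 (ltW c0) (ltW x0)) _.
  have : cc <= x / y by rewrite ge_min lexx orbT.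
  by rewrite -mulrA; lra.
apply/lee_addgt0Pr => eta eta0; apply: limn_einf_le.
pose K := walk_error y e cc.
have K0 : 0 <= K by exact: walk_error_ge0.
have cvg1 : (expR (K * n.+1%:R^-1) * (1 + 3 * (x / y))) @[n --> \oo] --> 1 + 3 * (x / y).
  have h : K * n.+1%:R^-1 @[n --> \oo] --> (0 : R).
    by rewrite -[X in _ --> X](mulr0 K); apply: cvgMr; exact: cvg_harmonic.
  have := cvg_comp _ _ h (@continuous_expR R 0); rewrite expR0 => h1.
  by rewrite -[X in _ --> X]mul1r; exact: cvgMl.
near=> n.
apply: le_trans (killed_walk2_expectation hW x ey cc01 (mesh01 n) (horizon n)) _.
rewrite -EFinD lee_fin.
have -> : K * mesh n ^+ 3 *+ horizon n = K * n.+1%:R^-1.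
  rewrite -mulr_natr /horizon natrX /mesh -exprVn -exprM -mulrA; congr (_ * _).
  by field; rewrite addrC natr1.
apply: le_trans (_ : expR (K * n.+1%:R^-1) * (1 + 3 * (x / y)) <= _).
  by rewrite ler_wpM2l ?expR_ge0.
have : `|1 + 3 * (x / y) - expR (K * n.+1%:R^-1) * (1 + 3 * (x / y))| <= eta.
  by near: n; move/cvgrPdist_le : cvg1; apply.
by rewrite ler_norml => /andP[? ?]; lra.
Unshelve. all: by end_near. Qed.

(** The two nested lower limits are over the mesh and over the window width y / (k + 1). [Psi] does
    not depend on r: one variable dominates all alive times, hence also their supremum. *)
Lemma exponential_moment : exists Psi : T -> \bar R,
  [/\ measurable_fun [set: T] Psi, (forall w, (0 <= Psi w)%E),
   (\int[P]_w Psi w <= (1 + 3 * (x / y))%:E)%E &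
   forall w r, 0 <= r -> alive W x r w ->
     ((expR (walk_rate y * (L (y - x) r w / 27)))%:E <= Psi w)%E].
Proof.
pose ee (k : nat) : R := y / k.+1%:R.
have eey k : 0 < ee k <= y.
  by rewrite divr_gt0//= ler_pdivrMr// ler_peMr ?(ltW y0)// ler1n.
pose G k w := limn_einf (fun n => (walk_functional (ee k) n w)%:E).
have mG k : measurable_fun [set: T] (G k).
  by apply: measurable_fun_limn_einf => n; exact: walk_functional_measurable.
have F0 k n w : (0 <= (walk_functional (ee k) n w)%:E)%E.
  by rewrite lee_fin ltW// killed_walk2_gt0.
have G0 k w : (0 <= G k w)%E by apply: limn_einf_ge; exact: nearW.
pose Psi w := limn_einf (fun k => G k w).
have IG k : (\int[P]_w G k w <= (1 + 3 * (x / y))%:E)%E.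
  apply: le_trans (walk_functional_expectation (eey k)).
  by apply: fatou => //; move=> n; exact: walk_functional_measurable.
exists Psi; split.
- exact: measurable_fun_limn_einf.
- by move=> w; apply: limn_einf_ge; exact: nearW.
- apply: le_trans (fatou P measurableT mG (fun k w _ => G0 k w)) _.
  by apply: limn_einf_le; exact: nearW.
move=> w r r0 al; apply: limn_einf_ge.
have [l0 lc occupation] := hL w.
have Gk k : ((expR (walk_rate y * (fine (occ (fun u => W u w) (y - x) r (ee k)) / (27 * ee k))))%:E <= G k w)%E.
  apply: limn_einf_ge; have := walk_functional_lower (eey k) r0 al.
  by apply: filterS => n; rewrite lee_fin.
have [lz|lpos] := leP (L (y - x) r w) 0.
  apply: nearW => k; apply: le_trans (Gk k).
  have /andP[e0 _] := eey k.
  rewrite lee_fin ler_expR; apply: (@le_trans _ _ 0).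
    by apply: mulr_ge0_le0 => //; exact: mulr_le0_ge0.
  apply: mulr_ge0 => //; apply: divr_ge0; first by apply: fine_ge0; exact: measure_ge0.
  by apply: mulr_ge0 => //; exact: ltW.
(* The error L / 2 in the occupation ratio is paid by the factor 2 in the window length 2 e, which
   leaves L / 27 in the exponent. *)
have l2 : 0 < L (y - x) r w / 2 by rewrite divr_gt0.
have [e1 e10 h] := @occ_near R (fun u => W u w) (fun y s => L y s w) l0 lc occupation (y - x) r _ r0 l2.
near=> k; apply: le_trans (Gk k).
have /andP[e0 _] := eey k.
have ee1 : ee k < e1.
  rewrite /ee mulrC -ltr_pdivlMr//; near: k; apply: near_invS_lt; exact: divr_gt0.
have /andP[+ +] := h (ee k) (introT andP (conj e0 ee1)).
case: (occ _ _ _ _) => //= o; rewrite !lee_fin => h1 _.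
rewrite ler_expR.
rewrite ler_wpM2l// ler_pdivlMr ?mulr_gt0//; move: h1.
have -> : L (y - x) r w / 27 * (27 * ee k) = 2 * ee k * (L (y - x) r w - L (y - x) r w / 2) by field.
by [].
Unshelve. all: by end_near. Qed.

End LocalTimeMoment.

(** * Oscillation of Brownian motion *)

Section Oscillation.
Context {R : realType} {d : measure_display} {T : measurableType d} {P : probability T R}.
Local Notation RT := (measurableTypeR R).
Variable W : R -> T -> R.
Hypothesis hW : std_brownian P W.

Let mW t : measurable_fun [set: T] (W t). Proof. by case: hW. Qed.
Let W0 w : W 0 w = 0. Proof. by case: hW. Qed.

Let mpre t (A : set R) : measurable A -> measurable [set w | A (W t w)].
Proof. by move=> mA; rewrite -[X in measurable X]setTI; exact: mW. Qed.

Let far (b : R) : set R := [set v | b <= `|v|].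

Let mfar b : measurable (far b).
Proof.
have mn : measurable_fun [set: R] (fun v : R => `|v|) by exact: normr_measurable.
have -> : far b = (fun v => `|v|) @^-1` `[b, +oo[%classic.
  by apply/seteqP; split => v /=; rewrite in_itv/= andbT.
by rewrite -[X in measurable X]setTI; apply: mn => //; exact: measurable_itv.
Qed.

Lemma brownian_tail (t b : R) : 0 <= t -> 0 < b ->
  (P [set w | far b (W t w)] <= (64 * t ^+ 2 / b ^+ 4)%:E)%E.
Proof.
move=> t0 b0; have [t00|tn] := eqVneq t 0.
  have -> : [set w | far b (W t w)] = set0.
    apply/seteqP; split => // w; rewrite /far /= t00 W0 normr0; lra.
  by rewrite measure0 lee_fin t00 expr0n mulr0 mul0r.
have tp : 0 < t by rewrite lt_neqAle eq_sym tn.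
have [_ _ _ /(_ 1%N (fun i => i%:R * t) (fun=> far b))] := hW.
rewrite mul0r => /(_ erefl) E.
have {E} -> : P [set w | far b (W t w)] = normal_prob 0 (Num.sqrt t) (far b).
  have := E (fun i _ => _) (fun i _ => mfar b); rewrite big_ord1 mulr1n mul1r mul0r subr0 => <-.
  - congr (P _); apply/seteqP; split => w /=.
      by move=> h i /=; rewrite ltnS leqn0 => /eqP ->; rewrite mul0r mulr1n mul1r W0 subr0.
    by move=> /(_ 0%N isT) /=; rewrite mul0r mulr1n mul1r W0 subr0.
  - by move=> i; rewrite ltr_pM2r// ltr_nat.
have s0 : 0 < Num.sqrt t by rewrite sqrtr_gt0.
have b4 : 0 < b ^+ 4 by rewrite exprn_gt0.
rewrite -(@lee_pmul2l _ (b ^+ 4)%:E) ?lte_fin// -EFinM.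
have -> : b ^+ 4 * (64 * t ^+ 2 / b ^+ 4) = 64 * Num.sqrt t ^+ 4.
  have -> : Num.sqrt t ^+ 4 = (Num.sqrt t ^+ 2) ^+ 2 by rewrite -exprM.
  by rewrite sqr_sqrtr// mulrC divfK// gt_eqF.
apply: le_trans (normal_prob_moment4 s0).
have m4 : measurable_fun [set: R] (fun v : R => (v ^+ 4)%:E).
  by apply/measurable_EFinP; exact: measurable_funX.
apply: (@le_trans _ _ (\int[normal_prob 0 (Num.sqrt t)]_(v in far b) (v ^+ 4)%:E)%E); last first.
  by apply: ge0_subset_integral => //; [exact: mfar|move=> v _; rewrite lee_fin exprn_even_ge0].
rewrite -integral_cst; last exact: mfar.
apply: ge0_le_integral => //.
- exact: mfar.
- by move=> v _; rewrite lee_fin ltW.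
- exact: measurable_funTS.
- move=> v /= bv; rewrite lee_fin.
  have -> : v ^+ 4 = `|v| ^+ 4 by rewrite -normrX ger0_norm// exprn_even_ge0.
  by rewrite lerXn2r// ?nnegrE ?(ltW b0).
Qed.

(** The boolean selects W or -W, so that both one-sided statements share one proof. *)
Let sg (b : bool) (v : R) : R := if b then v else - v.
Let above b (c : R) : set R := [set v | - c < sg b v].

Let mabove b c : measurable (above b c).
Proof.
have mn : measurable_fun [set: R] (sg b) by case: b; [exact: measurable_id|exact: oppr_measurable].
have -> : above b c = sg b @^-1` `]- c, +oo[%classic.
  by apply/seteqP; split => v /=; rewrite in_itv/= andbT.
by rewrite -[X in measurable X]setTI; apply: mn => //; exact: measurable_itv.
Qed.

Lemma normal_prob_above b (s : R) : 0 < s ->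
  (normal_prob 0 s (above b s) <= (1 - gauss_mass)%:E)%E.
Proof.
move=> s0.
have Np : (gauss_mass%:E <= normal_prob 0 s (~` above b s))%E.
  case: b.
    apply: le_trans (normal_prob_ge s0) _.
    rewrite -(normal_prob_itvN (negbT (gt_eqF s0))); last exact: measurable_itv.
    apply: le_measure; rewrite ?inE.
    - rewrite -[X in measurable X]setTI; apply: oppr_measurable => //; exact: measurable_itv.
    - by apply: measurableC; exact: mabove.
    - by move=> v; rewrite /above/= in_itv/= => /andP[? _] ?; lra.
  apply: le_trans (normal_prob_ge s0) _.
  apply: le_measure; rewrite ?inE; first exact: measurable_itv.
  - by apply: measurableC; exact: mabove.
  - by move=> v; rewrite /above/= in_itv/= => /andP[? _] ?; lra.
have : (normal_prob 0 s (above b s) + normal_prob 0 s (~` above b s) = 1)%E.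
  rewrite -measureU//; first by rewrite setUv; exact: (@probability_setT _ _ _ (normal_prob 0 s : probability RT R)).
  - exact: mabove.
  - by apply: measurableC; exact: mabove.
  - exact: setICr.
have fin A : measurable A -> normal_prob 0 s A \is a fin_num by exact: fin_num_measure.
have := fin _ (mabove b s); have := fin _ (measurableC (mabove b s)).
case: (normal_prob 0 s _) Np => // p hp _; case: (normal_prob 0 s _) => // q _.
rewrite -EFinD => -[pq]; move: hp; rewrite !lee_fin; lra.
Qed.

Definition stays_above b (c : R) : set T := \bigcap_(n : nat) [set w | above b c (W n%:R w)].

Lemma measurable_stays_above b c : measurable (stays_above b c).
Proof. by apply: bigcapT_measurable => n; apply: mpre; exact: mabove. Qed.

(** At the k-th time the position exceeds s k / 2 with probability O(q^-2) only, where s k is the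
    standard deviation of the next increment. Otherwise, staying above -c forces that increment
    above -c - s k / 2 >= - s k; these M independent events have probability at most 1 -
    [gauss_mass] each. *)
Lemma stays_above_bound b c (q M : nat) : 0 < c -> 4 * c ^+ 2 <= q%:R -> (0 < q)%N ->
  (P (stays_above b c) <= (M%:R * ((64 * 16) / q%:R ^+ 2) + (1 - gauss_mass) ^+ M)%:E)%E.
Proof.
move=> c0 cq q0.
(* Geometric growth makes each increment dominate the past; subtracting 1 starts the grid at time 0,
   as [std_brownian] requires. *)
pose tt (k : nat) : R := (q.+1 ^ k - 1)%N%:R.
have ttE k : tt k = q.+1%:R ^+ k - 1.
  by rewrite /tt natrB ?expn_gt0// natrX.
pose var k : R := tt k.+1 - tt k.
have varE k : var k = q.+1%:R ^+ k * q%:R.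
  by rewrite /var !ttE exprS -natr1; ring.
have qR : 0 < q%:R :> R by rewrite ltr0n.
have pk k : 1 <= q.+1%:R ^+ k :> R by rewrite exprn_ege1// ler1n.
have varq k : q%:R <= var k by rewrite varE ler_peMl// ltW.
have var0 k : 0 < var k by exact: lt_le_trans (varq k).
pose s k := Num.sqrt (var k).
have s0 k : 0 < s k by rewrite sqrtr_gt0.
have s2 k : s k ^+ 2 = var k by rewrite sqr_sqrtr// ltW.
have sc k : 2 * c <= s k.
  rewrite -(@ler_pXn2r _ 2)// ?nnegrE ?mulr_ge0 ?(ltW c0) ?(ltW (s0 k))//.
  by rewrite s2 exprMn; apply: le_trans (varq k); lra.
pose Bad k := [set w | far (s k / 2) (W (tt k) w)].
pose G := \bigcap_(k in [set k | (k < M)%N]) [set w | above b (s k) (W (tt k.+1) w - W (tt k) w)].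
have mBad k : measurable (Bad k) by apply: mpre; exact: mfar.
have mG : measurable G.
  apply: bigcap_measurableType => k _.
  have md : measurable_fun [set: T] (fun w => W (tt k.+1) w - W (tt k) w) by exact: measurable_funB.
  by rewrite -[X in measurable X]setTI; apply: md => //; exact: mabove.
have sub : stays_above b c `<=` \big[setU/set0]_(k < M) Bad k `|` G.
  move=> w hw; have [|nb] := pselect ((\big[setU/set0]_(k < M) Bad k) w); first by left.
  right => k /= kM.
  have nbk : `|W (tt k) w| < s k / 2.
    rewrite ltNge; apply/negP => h; apply: nb; rewrite -bigcup_mkord; exists k => //.
  have := hw (q.+1 ^ k.+1 - 1)%N I; rewrite /= -/(tt k.+1) /above/=.
  move: nbk; rewrite ltr_norml => /andP[? ?]; have := sc k.
  by rewrite /sg; case: (b); lra.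
apply: (@le_trans _ _ (P (\big[setU/set0]_(k < M) Bad k) + P G)%E).
  apply: (@le_trans _ _ (P (\big[setU/set0]_(k < M) Bad k `|` G))).
    apply: le_measure => //; rewrite inE; first exact: measurable_stays_above.
    by apply: measurableU => //; exact: bigsetU_measurable.
  by apply: measureU2 => //; exact: bigsetU_measurable.
rewrite EFinD; apply: leeD.
  apply: le_trans (Boole_inequality _ (fun k _ => mBad k)) _.
  have -> : (M%:R * ((64 * 16) / q%:R ^+ 2))%:E = (\sum_(k < M) ((64 * 16) / q%:R ^+ 2)%:E)%E :> \bar R.
    by rewrite sumEFin sumr_const card_ord mulr_natl.
  apply: lee_sum => k _.
  have tt0 : 0 <= tt k by exact: ler0n.
  apply: le_trans (brownian_tail tt0 (divr_gt0 (s0 k) (ltr0n _ 2))) _.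
  rewrite lee_fin.
  have -> : (s k / 2) ^+ 4 = var k ^+ 2 / 16.
    by rewrite -s2; field.
  rewrite ler_pdivrMr ?divr_gt0 ?exprn_gt0//.
  have -> : 64 * 16 / q%:R ^+ 2 * (var k ^+ 2 / 16) = 64 * (q.+1%:R ^+ k) ^+ 2.
    by rewrite varE; field; rewrite gt_eqF.
  rewrite ler_wpM2l// lerXn2r ?nnegrE// ?exprn_ge0//.
  by rewrite ttE; lra.
have [_ _ _ /(_ M tt (fun k => above b (s k)))] := hW.
rewrite {1}/tt expn0 subnn => /(_ erefl) E.
rewrite /G E; last 2 first.
- by move=> k _; rewrite -subr_gt0; exact: var0.
- by move=> k _; exact: mabove.
have -> : ((1 - gauss_mass) ^+ M)%:E = (\prod_(k < M) (1 - gauss_mass)%:E)%E :> \bar R.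
  by rewrite prodEFin prodr_const card_ord.
suff : (0 <= \prod_(k < M) normal_prob 0 (s k) (above b (s k)) /\
  \prod_(k < M) normal_prob 0 (s k) (above b (s k)) <= \prod_(k < M) (1 - gauss_mass)%:E)%E by case.
apply: (big_ind2 (fun u v : \bar R => (0 <= u /\ u <= v)%E)).
- by rewrite lee01.
- by move=> u1 v1 u2 v2 [a1 a2] [a3 a4]; split; [exact: mule_ge0|exact: lee_pmul].
- by move=> k _; split; [exact: measure_ge0|exact: normal_prob_above].
Qed.

Lemma stays_above_null b c : 0 < c -> P (stays_above b c) = 0%E.
Proof.
move=> c0; apply/eqP; rewrite eq_le measure_ge0 andbT.
have fin : P (stays_above b c) \is a fin_num by apply: fin_num_measure; exact: measurable_stays_above.
have p1 : 0 <= (1 - gauss_mass : R) < 1.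
  have g0 : 0 < gauss_mass :> R by exact: gauss_mass_gt0.
  have := normal_prob_above true (@ltr01 R).
  have : (0 <= normal_prob 0 1 (above true 1))%E by exact: measure_ge0.
  case: (normal_prob 0 1 _) => [r||]//; rewrite !lee_fin.
  by move=> r0 r1; apply/andP; split; lra.
apply/lee_addgt0Pr => eta eta0; rewrite add0e.
have /andP[g1 g2] := p1.
have [a [a0 ha]] : exists a : R, 0 <= a /\ forall q M : nat, 4 * c ^+ 2 <= q%:R -> (0 < q)%N ->
    (P (stays_above b c) <= (M%:R * (a / q%:R ^+ 2) + (1 - gauss_mass) ^+ M)%:E)%E.
  exists (64 * 16); split; first by rewrite mulr_ge0 ?ler0n.
  by move=> q M; exact: stays_above_bound.
have : (1 - gauss_mass) ^+ n @[n --> \oo] --> (0 : R).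
  by apply: cvg_expr; rewrite ger0_norm.
move=> /cvgrPdist_le/(_ _ (divr_gt0 eta0 (ltr0n _ 2)))[M _ /(_ M (leqnn _))]/=.
rewrite sub0r normrN ger0_norm ?exprn_ge0// => hM.
(* M is already fixed by the geometric term; q is now taken so large that M a / q^2 <= eta / 2. *)
pose z := 4 * c ^+ 2 + 2 * (a * M%:R) / eta + 1.
pose q := (Num.truncn z).+1.
have zq : z < q%:R by exact: truncnS_gt.
have h1 : 0 <= 2 * (a * M%:R) / eta by rewrite divr_ge0 ?mulr_ge0 ?ler0n// ltW.
have h2 : 0 <= 4 * c ^+ 2 by rewrite mulr_ge0// sqr_ge0.
have z1 : 1 <= z.
  by rewrite /z lerDr addr_ge0.
apply: le_trans (ha q M _ _) _ => //.
  by apply: le_trans (ltW zq); rewrite /z; lra.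
rewrite lee_fin.
have q1 : 1 <= q%:R :> R by apply: le_trans z1 (ltW zq).
have : M%:R * (a / q%:R ^+ 2) <= eta / 2.
  have q0 : 0 < q%:R :> R by exact: lt_le_trans q1.
  rewrite mulrA ler_pdivrMr ?exprn_gt0//.
  apply: le_trans (_ : eta / 2 * q%:R <= _); last first.
    apply: ler_wpM2l; first by rewrite divr_ge0// ltW.
    by rewrite expr2; apply: ler_peMl => //; exact: ltW.
  rewrite -ler_pdivrMl ?divr_gt0//.
  apply: le_trans (ltW zq); rewrite /z invfM invrK.
  have -> : eta^-1 * 2 * (M%:R * a) = 2 * (a * M%:R) / eta by ring.
  by lra.
by lra.
Qed.

Lemma brownian_oscillates (c : R) : 0 < c -> exists N : set T,
  [/\ measurable N, P N = 0%E & forall w, ~ N w ->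
    exists i j : nat, [/\ (i < j)%N, W i%:R w <= - c & - c < W j%:R w]].
Proof.
move=> c0; pose up := \bigcup_(n : nat) stays_above false n.+1%:R.
have mup : measurable up by apply: bigcupT_measurable => n; exact: measurable_stays_above.
have ms := measurable_stays_above true c.
exists (stays_above true c `|` up); split; first exact: measurableU.
  apply/eqP; rewrite eq_le measure_ge0 andbT.
  apply: le_trans (measureU2 _ ms mup) _.
  rewrite [X in (X + _)%E](_ : _ = 0%E) ?add0e; last exact: stays_above_null.
  apply: le_trans (generalized_Boole_inequality _ _ mup) _.
    by move=> n; exact: measurable_stays_above.
  by rewrite eseries0// => n _ _; exact: stays_above_null.
move=> w /not_orP[/existsNP[i /not_implyP[_ ni]] nup].
have {}ni : W i%:R w <= - c by move: ni; rewrite /above/= => /negP; rewrite -leNgt.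
(* No index up to i reaches a value above z, which forces j > i. *)
pose z := c + \sum_(k < i.+1) `|W k%:R w|.
pose n := Num.truncn z.
have zn : z < n.+1%:R by exact: truncnS_gt.
have : ~ stays_above false n.+1%:R w by move=> h; apply: nup; exists n.
move=> /existsNP[j /not_implyP[_ /negP]]; rewrite -leNgt /sg => nj.
have z0 : 0 <= \sum_(k < i.+1) `|W k%:R w| by apply: sumr_ge0.
exists i, j; split => //; last by rewrite /z in zn; lra.
rewrite ltnNge; apply/negP => ji.
have : W j%:R w <= \sum_(k < i.+1) `|W k%:R w|.
  apply: le_trans (ler_norm _) _.
  rewrite (bigD1 (Ordinal (ji : (j < i.+1)%N)))//= lerDl; exact: sumr_ge0.
by rewrite /z in zn; lra.
Qed.

End Oscillation.

(** * The threshold *)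

Section Threshold.
Context {R : realType}.
Variables (m : {measure set R -> \bar R}) (C rho : R).
Hypothesis int_infty : (\int[m]_(y in [set y : R | (1 <= y)%R]) y%:E < +oo)%E.
Hypothesis int_zero : (\int[m]_(y in [set y : R | (0 < y <= 1)%R]) y%:E < +oo)%E.
Hypotheses (C0 : 0 < C) (rho0 : 0 < rho).
Hypothesis int_rho : forall x, 0 < x < 1 ->
  (\int[m]_(y in [set y : R | (0 < y <= x)%R]) y%:E <= (C * x `^ rho)%:E)%E.

Let unit_itv (x : R) : set R := [set y : R | 0 < y <= x].

Let m_unit x : measurable (unit_itv x).
Proof.
by have -> : unit_itv x = `]0, x]%classic; [apply/seteqP; split => y /=; rewrite in_itv|exact: measurable_itv].
Qed.

Let theta : R := rho / 2.
Let theta0 : 0 < theta. Proof. by rewrite divr_gt0. Qed.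
Let r : R := 2 `^ theta.
Let r0 : 0 < r. Proof. by rewrite powR_gt0. Qed.
Let r1 : 1 < r. Proof. by rewrite /r /powR gt_eqF// expR_gt1 mulr_gt0// ln_gt0 ?ltr1n. Qed.

Let pow2N (n : nat) : (2 ^- n) `^ theta = r ^- n.
Proof.
by rewrite -[in LHS](powR_invn n (ler0n R 2)) -powRrM mulrC powRrM powR_invn ?powR_ge0.
Qed.

(** On the layer 2^-(j+1) < y <= 2^-j the weight y^(-theta) is at most r^(j+1), while I(2^-j) <= C
    r^(-2j) because rho = 2 theta: half of the exponent is spent on the weight, the other half sums
    a geometric series. *)
Lemma dyadic_integral : (\int[m]_(y in unit_itv 1) (y * y `^ (- theta))%:E < +oo)%E.
Proof.
pose u (j : nat) (y : R) : \bar R := ((r ^+ j.+1)%:E * (y * \1_(unit_itv (2 ^- j)) y)%:E)%E.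
have uge0 j y : unit_itv 1 y -> (0 <= u j y)%E.
  by move=> /andP[y0 _]; rewrite /u -EFinM lee_fin !mulr_ge0// ltW// exprn_gt0.
have mu_ j : measurable_fun (unit_itv 1) (u j).
  by apply: emeasurable_funM => //; apply/measurable_EFinP; apply: measurable_funM.
have le_series y : unit_itv 1 y -> ((y * y `^ (- theta))%:E <= \sum_(0 <= j <oo) u j y)%E.
  move=> y01; have /andP[y0 y1] := y01.
  have ex : exists n, 2 ^- n < y.
    exists (Num.truncn y^-1).+1; rewrite -[ltRHS]invrK ltf_pV2 ?posrE ?invr_gt0 ?exprn_gt0//.
    apply: lt_trans (truncnS_gt _) _; rewrite -natrX ltr_nat; exact: ltn_expl.
  case: (ex_minnP ex) => -[|j].
    by rewrite expr0 invr1 ltNge y1.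
  move=> jy jmin; have yj : y <= 2 ^- j.
    by rewrite leNgt; apply/negP => /jmin; rewrite ltnn.
  apply: le_trans (@nneseries_lim_ge _ (u ^~ y) xpredT 0 j.+1 (fun n _ _ => uge0 n y y01)).
  rewrite big_mkord big_ord_recr/=.
  apply: (@le_trans _ _ (u j y)); last first.
    by rewrite leeDr//; apply: sume_ge0 => i _; exact: uge0.
  rewrite /u indicE mem_set; last by rewrite /unit_itv/= y0 yj.
  rewrite mulr1 -EFinM lee_fin mulrC ler_pM2r//.
  rewrite powRN -[leRHS]invrK lef_pV2 ?posrE ?invr_gt0 ?exprn_gt0 ?powR_gt0// -pow2N.
  by apply: ge0_ler_powR; rewrite ?nnegrE ?invr_ge0 ?exprn_ge0// ltW.
have my : measurable_fun (unit_itv 1) (fun y : R => (y * y `^ (- theta))%:E).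
  apply/measurable_EFinP; apply: measurable_funM => //; apply: measurable_funTS; exact: measurable_powR.
apply: (@le_lt_trans _ _ (\int[m]_(y in unit_itv 1) (\sum_(0 <= j <oo) u j y))%E).
  apply: ge0_le_integral => //.
  - by move=> y /andP[y0 _]; rewrite lee_fin mulr_ge0 ?powR_ge0// ltW.
  - by apply: ge0_emeasurable_sum => // j y y01 _; exact: uge0.
rewrite integral_nneseries//.
pose I x : \bar R := (\int[m]_(y in unit_itv x) y%:E)%E.
have IE j : (\int[m]_(y in unit_itv 1) u j y)%E = ((r ^+ j.+1)%:E * I (2 ^- j))%E.
  have j1 : 2 ^- j <= 1 :> R by rewrite invf_le1 ?exprn_gt0// exprn_ege1// ler1n.
  rewrite ge0_integralZl_EFin ?exprn_ge0 ?(ltW r0)//; last 2 first.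
  - by move=> y /andP[y0 _]; rewrite lee_fin mulr_ge0// ltW.
  - by apply/measurable_EFinP; apply: measurable_funM => //; exact: measurable_indic.
  congr (_ * _)%E; rewrite /I [LHS]integral_mkcond [RHS]integral_mkcond.
  apply: eq_integral => y _; rewrite !patchE indicE.
  case: (boolP (y \in unit_itv (2 ^- j))) => [|_]; last by case: ifP => // _; rewrite mulr0.
  rewrite inE => /andP[y0 yj]; rewrite mem_set ?mulr1//.
  by rewrite /unit_itv/= y0 (le_trans yj j1).
(* The layer j = 0 involves I(1), outside the range x < 1 of the power bound. *)
have I1 : exists2 M, 0 <= M & I 1 = M%:E.
  have : (0 <= I 1%R)%E by apply: integral_ge0 => y /andP[y0 _]; rewrite lee_fin ltW.
  by move: int_zero; rewrite -/(I 1%R); case: (I 1%R) => // M _; exists M.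
have [M M0 IM] := I1.
pose D := C * r + M * r.
have D0 : 0 <= D by rewrite addr_ge0 ?mulr_ge0// ltW.
have term j : (\int[m]_(y in unit_itv 1) u j y <= (D * r ^- j)%:E)%E.
  rewrite IE; case: j => [|j].
    rewrite expr0 invr1 IM -EFinM lee_fin mulr1 expr1 mulrC /D lerDr mulr_ge0// ltW//.
  have xj : 0 < (2 ^- j.+1 : R) < 1.
    by rewrite invr_gt0 exprn_gt0//= invf_lt1 ?exprn_gt0// exprn_egt1// ltr1n.
  apply: (@le_trans _ _ ((r ^+ j.+2)%:E * (C * (2 ^- j.+1) `^ rho)%:E)%E).
    by rewrite lee_wpmul2l ?lee_fin ?exprn_ge0 ?(ltW r0)//; exact: int_rho.
  have -> : rho = theta * 2%:R by rewrite /theta divfK.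
  rewrite powRrM powR_mulrn ?powR_ge0// pow2N -EFinM lee_fin.
  have -> : r ^+ j.+2 * (C * (r ^- j.+1) ^+ 2) = C * r * r ^- j.+1.
    rewrite [r ^+ j.+2]exprS; set z := r ^+ j.+1.
    by field; rewrite /z gt_eqF// exprn_gt0.
  by rewrite ler_wpM2r ?invr_ge0 ?exprn_ge0 ?(ltW r0)// /D lerDl mulr_ge0// ltW.
apply: (@le_lt_trans _ _ (D * (1 - r^-1)^-1)%:E); last by rewrite ltry.
have ri : 0 < 1 - r^-1 by rewrite subr_gt0 invf_lt1.
apply: lime_le.
  apply: is_cvg_nneseries => n _ _; apply: integral_ge0 => y y01; exact: uge0.
apply: nearW => n.
apply: (@le_trans _ _ (\sum_(0 <= j < n) (D * r ^- j)%:E)%E); first by apply: lee_sum => j _; exact: term.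
rewrite sumEFin lee_fin -mulr_sumr ler_wpM2l//.
rewrite -[leRHS]mul1r ler_pdivlMr//.
have -> : (\sum_(0 <= j < n) r ^- j) * (1 - r^-1) = 1 - r ^- n.
  elim: n => [|n IH]; first by rewrite big_geq// mul0r expr0 invr1 subrr.
  by rewrite big_nat_recr//= mulrDl IH [r ^+ n.+1]exprS invfM; ring.
by rewrite gerBl invr_ge0 exprn_ge0// ltW.
Qed.

Lemma expR_ge_powN (n : nat) (v : R) : 0 <= v -> (v / n.+1%:R) ^+ n.+1 <= expR v.
Proof.
move=> v0; have -> : expR v = expR (v / n.+1%:R) ^+ n.+1.
  by rewrite -expRM_natr divfK.
rewrite lerXn2r ?nnegrE ?expR_ge0 ?divr_ge0//.
by apply: le_trans (expR_ge1Dx _); rewrite lerDr.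
Qed.

(* Integrability of y^(1 - theta) near 0 is where the assumption on I(x) enters. *)
Lemma threshold (kappa tau : R) : 0 < kappa -> 0 < tau ->
  exists b : R -> R, [/\ measurable_fun [set: R] b, (forall y, 0 <= b y),
    (\int[m]_(y in [set y : R | (0 < y)%R]) (b y)%:E <= tau%:E)%E &
    exists2 K, 0 <= K & forall y, 0 < y -> expR (- (kappa * (b y / y))) <= K * y].
Proof.
move=> k0 t0.
have h0 y : unit_itv 1 y -> (0 <= (y * y `^ (- theta))%:E)%E.
  by move=> /andP[y0 _]; rewrite lee_fin mulr_ge0 ?powR_ge0// ltW.
move: dyadic_integral; set H := (X in (X < _)%E -> _) => Hfin.
have H0 : (0 <= H)%E by apply: integral_ge0 => y; exact: h0.
have [h [hh0 HE]] : exists h, 0 <= h /\ H = h%:E.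
  by move: Hfin H0; case: H => // h _ hh; exists h.
(* The added 1 keeps the denominator positive when h = 0. *)
pose c := tau / (h + 1).
have c0 : 0 < c by rewrite divr_gt0// ltr_wpDl.
pose b y := if 0 < y <= 1 then c * (y * y `^ (- theta)) else 0.
have mh : measurable_fun [set: R] (fun y : R => c * (y * y `^ (- theta))).
  by apply: measurable_funM => //; apply: measurable_funM => //; exact: measurable_powR.
exists b; split.
- apply: measurable_fun_ifT => //.
  by apply: measurable_and; [exact: measurable_fun_ltr|exact: measurable_fun_ler].
- move=> y; rewrite /b; case: ifP => // /andP[y0 _].
  by apply: mulr_ge0; [exact: ltW|apply: mulr_ge0; [exact: ltW|exact: powR_ge0]].
- have -> : (\int[m]_(y in [set y : R | (0 < y)%R]) (b y)%:E)%E = (c%:E * H)%E.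
    rewrite /H -ge0_integralZl_EFin//; last 2 first.
    + by apply/measurable_EFinP; apply: measurable_funTS; apply: measurable_funM => //; exact: measurable_powR.
    + exact: ltW.
    rewrite [LHS]integral_mkcond [RHS]integral_mkcond; apply: eq_integral => y _.
    rewrite !patchE /b; case: (boolP (y \in [set y : R | (0 < y)%R])); case: (boolP (y \in unit_itv 1)) => //.
    + by rewrite inE/= => -> _; rewrite EFinM.
    + by move=> /negP; rewrite inE/= => /negP/negbTE -> _.
    + by rewrite inE/= => /andP[y0 _] /negP; rewrite inE/= y0.
  rewrite HE -EFinM lee_fin /c mulrAC ler_pdivrMr ?ltr_wpDl//.
  by rewrite ler_wpM2l ?(ltW t0)// lerDl.
(* Chosen so that theta (n + 1) >= 1: the exponential beats the power n + 1, and y^(theta (n + 1))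
   <= y on (0, 1]. *)
pose n := Num.truncn theta^-1.
have nt : 1 <= theta * n.+1%:R.
  by rewrite -ler_pdivrMl// mulr1 ltW// truncnS_gt.
have n0 : 0 < n.+1%:R :> R by [].
pose K := (n.+1%:R / (kappa * c)) ^+ n.+1.
have kc : 0 < kappa * c by exact: mulr_gt0.
have K0 : 0 <= K by rewrite exprn_ge0// divr_ge0// ltW.
(* The added 1 serves y > 1, where b vanishes and the exponential is 1 <= y. *)
exists (K + 1); first by rewrite addr_ge0.
move=> y y0; rewrite /b y0/=; case: ifPn => [y1|]; last first.
  rewrite -ltNge => y1; rewrite mul0r mulr0 oppr0 expR0.
  have : 0 <= K * y by rewrite mulr_ge0// ltW.
  by rewrite mulrDl mul1r; lra.
apply: le_trans (_ : K * y <= _); last by rewrite mulrDl mul1r lerDl ltW.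
have -> : kappa * (c * (y * y `^ (- theta)) / y) = kappa * c * y `^ (- theta).
  by field; rewrite gt_eqF.
set p := y `^ (- theta).
have p0 : 0 < p by rewrite powR_gt0.
rewrite expRN.
have e1 := expR_ge_powN n (ltW (mulr_gt0 kc p0)).
have e2 : 0 < (kappa * c * p / n.+1%:R) ^+ n.+1 by rewrite exprn_gt0// divr_gt0// mulr_gt0.
apply: le_trans (_ : ((kappa * c * p / n.+1%:R) ^+ n.+1)^-1 <= _).
  by rewrite lef_pV2 ?posrE ?expR_gt0.
have -> : ((kappa * c * p / n.+1%:R) ^+ n.+1)^-1 = K * (p ^+ n.+1)^-1.
  rewrite /K -!exprVn -exprMn; congr (_ ^+ _); field.
  by rewrite !gt_eqF// addrC natr1.
rewrite ler_wpM2l// -[leRHS]invrK lef_pV2 ?posrE ?invr_gt0 ?exprn_gt0//.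
rewrite /p -powR_mulrn ?powR_ge0// -powRrM -(powR_inv1 (ltW y0)).
by apply: ger_powR; [rewrite y0|rewrite mulNr lerN2].
Qed.

Lemma integral_id_finite : (\int[m]_(y in [set y : R | (0 < y)%R]) y%:E < +oo)%E.
Proof.
have mB : measurable [set y : R | (1 <= y)%R].
  have -> : [set y : R | (1 <= y)%R] = `[1, +oo[%classic.
    by apply/seteqP; split => y /=; rewrite in_itv/= andbT.
  exact: measurable_itv.
have mB' : measurable [set y : R | (1 < y)%R].
  have -> : [set y : R | (1 < y)%R] = `]1, +oo[%classic.
    by apply/seteqP; split => y /=; rewrite in_itv/= andbT.
  exact: measurable_itv.
have -> : [set y : R | (0 < y)%R] = unit_itv 1 `|` [set y : R | (1 < y)%R].
  apply/seteqP; split => y /=; last by move=> [/andP[]//|]; exact: lt_trans.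
  by move=> y0; have [y1|y1] := leP y 1; [left; rewrite /unit_itv/= y0|right].
rewrite ge0_integral_setU//=; last 2 first.
- by move=> y [/andP[y0 _]|y1]; rewrite lee_fin ltW// (lt_trans ltr01).
- by apply/disj_setPS => y [/= /andP[_ y1] /(le_lt_trans y1)]; rewrite ltxx.
apply: lte_add_pinfty => //.
apply: le_lt_trans int_infty; apply: ge0_subset_integral => //.
- by move=> y /= y1; rewrite lee_fin (le_trans ler01).
- by move=> y /= /ltW.
Qed.

End Threshold.

(** * The tail of the lifetime *)

Section Excess.
Context {R : realType} {d : measure_display} {T : measurableType d} {P : probability T R}.
Variables (W : R -> T -> R) (L : R -> R -> T -> R) (m : {measure set R -> \bar R}) (x : R) (b : R -> R).
Hypothesis hW : std_brownian P W.
Hypothesis hL : local_time W L.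
Hypothesis hm : speed_measure m.
Hypothesis x0 : 0 < x.
Hypothesis mb : measurable_fun [set: R] b.
Hypothesis b0 : forall y, 0 <= b y.

Let mW t : measurable_fun [set: T] (W t). Proof. by case: hW. Qed.
Let W0 w : W 0 w = 0. Proof. by case: hW. Qed.
Let cW w : {within `[0, +oo[, continuous (fun s => W s w)}. Proof. by case: hW. Qed.
Let l0 w y s : 0 <= L y s w. Proof. by case: (hL w). Qed.
Let lc w : {within [set p : R * R | 0 <= p.2], continuous (fun p : R * R => L p.1 p.2 w)}.
Proof. by case: (hL w). Qed.
Let occupation w s : 0 <= s -> forall A : set R, measurable A ->
  lebesgue_measure (`[0, s]%classic `&` [set u | A (W u w)]) =
  (\int[lebesgue_measure]_(y in A) (L y s w)%:E)%E.
Proof. by case: (hL w) => _ _; apply. Qed.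

(** Scale-free form of the rate: local times at level y have order y, so the exponent available
    there is [moment_rate / y]. *)
Definition moment_rate : R := gauss_mass / 20 / 27.

Lemma moment_rate_gt0 : 0 < moment_rate.
Proof. by rewrite !divr_gt0// gauss_mass_gt0. Qed.

Lemma walk_rateE y : 0 < y -> walk_rate y / 27 = moment_rate / y.
Proof. by move=> y0; rewrite /walk_rate /moment_rate; field; rewrite gt_eqF. Qed.

(* The local time at level y accumulated before the hitting time of 0. *)
Definition peak (p : R * T) : \bar R :=
  ereal_sup (range (fun n => if `[< alive W x (nnrat n) p.2 >]
    then positive_local_time L x (nnrat n) p else 0%E)).

Definition excess (p : R * T) : \bar R := maxe (peak p - (b p.1)%:E)%E 0%E.

Lemma excess_ge0 p : (0 <= excess p)%E.
Proof. by rewrite /excess le_max lexx orbT. Qed.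

Lemma peak_ge0 p : (0 <= peak p)%E.
Proof.
apply: le_trans (ereal_sup_ubound _); last by exists 0%N.
by case: asboolP => // _; exact: (positive_local_time_ge0 x hL).
Qed.

Lemma peak_le0 y w : y <= 0 -> peak (y, w) = 0%E.
Proof.
move=> y0; apply/eqP; rewrite eq_le peak_ge0 andbT; apply: ge_ereal_sup => _ [n _ <-].
by case: asboolP => // _; rewrite /positive_local_time/= ltNge y0.
Qed.

Lemma measurable_peak : measurable_fun [set: R * T] peak.
Proof.
apply: measurable_ereal_sup_range => n.
apply: (measurable_if_alive mW W0 cW x0 (V := snd)) => //; first exact: nnrat_ge0.
exact: (measurable_positive_local_time x mW cW hL (nnrat_ge0 n)).
Qed.

Lemma measurable_excess : measurable_fun [set: R * T] excess.
Proof.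
apply: measurable_maxe => //; apply: emeasurable_funB; first exact: measurable_peak.
by apply/measurable_EFinP; apply: (measurableT_comp mb); exact: measurable_fst.
Qed.

Lemma lifetime_le_peak w : (lifetime W L m x w <= \int[m]_y peak (y, w))%E.
Proof.
apply: lifetime_le => [|n al]; first by apply: integral_ge0 => y _; exact: peak_ge0.
rewrite add_funE; apply: ge0_le_integral => //.
- by move=> y _; exact: (positive_local_time_ge0 x hL).
- have mp := measurable_positive_local_time x mW cW hL (nnrat_ge0 n).
  by apply: (measurableT_comp mp); exact: measurable_pair2.
- by apply: (measurableT_comp measurable_peak); exact: measurable_pair2.
- move=> y _; apply: ereal_sup_ubound; exists n => //=.
  by case: asboolP.
Qed.

(** The 1 in the mean 1 + 3 x / y has to cancel, or the bound would not vanish with x. It does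
    because the excess is at most Kc (Psi - 1); the inequality is kept additive since [Psi] may be
    infinite. *)
Lemma excess_expectation y : 0 < y ->
  (\int[P]_w excess (y, w) <= (3 * x / moment_rate * expR (- (moment_rate * (b y / y))))%:E)%E.
Proof.
move=> y0; have [Psi [mPsi Psi0 EPsi hPsi]] := exponential_moment hW hL x0 y0.
have k0 := moment_rate_gt0.
pose a := moment_rate / y; have a0 : 0 < a by rewrite divr_gt0.
have rateE z : walk_rate y * (z / 27) = a * z.
  by rewrite /a -(walk_rateE y0) mulrA mulrAC.
pose Kc := expR (- (a * b y)) / a.
have Kc0 : 0 < Kc by rewrite divr_gt0// expR_gt0.
have Psi1 w : (1%:E <= Psi w)%E.
  have al : alive W x 0 w.
    move=> u u0; have -> : u = 0 by apply/eqP; rewrite eq_le andbC.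
    by rewrite W0 addr0.
  apply: le_trans (hPsi w 0 (lexx _) al); rewrite rateE lee_fin.
  by rewrite -expR0 ler_expR mulr_ge0// ltW.
have pointwise w : (excess (y, w) + Kc%:E <= Kc%:E * Psi w)%E.
  have := Psi1 w; have := hPsi w; case: (Psi w) => [z| |] hz //; last first.
    by move=> _; rewrite gt0_muley ?lte_fin// leey.
  rewrite lee_fin => z1.
  have hpeak : (peak (y, w) <= (b y + Kc * (z - 1))%:E)%E.
    have bz : 0 <= b y + Kc * (z - 1) by rewrite addr_ge0// mulr_ge0 ?(ltW Kc0)// subr_ge0.
    apply: ge_ereal_sup => _ [n _ <-]; case: asboolP => [al|_]; last by rewrite lee_fin.
    rewrite /positive_local_time/= y0 lee_fin; set l := L _ _ _.
    have := hz _ (nnrat_ge0 n) al; rewrite rateE lee_fin -/l => lz.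
    (* The 1 on the left pays, through e2, for exp(- a b): this is what turns Psi into Psi - 1. *)
    have e1 : 1 + a * (l - b y) <= expR (- (a * b y)) * z.
      apply: le_trans (expR_ge1Dx _) _.
      rewrite mulrBr addrC expRD ler_wpM2l ?expR_ge0//.
    have e2 : expR (- (a * b y)) <= 1.
      by rewrite -expR0 ler_expR oppr_le0 mulr_ge0// ltW.
    rewrite -lerBlDl /Kc -(ler_pM2l a0).
    have -> : a * (expR (- (a * b y)) / a * (z - 1)) =
      expR (- (a * b y)) * z - expR (- (a * b y)) by field; rewrite gt_eqF.
    by lra.
  have hex : (excess (y, w) <= (Kc * (z - 1))%:E)%E.
    rewrite /excess ge_max lee_fin mulr_ge0 ?subr_ge0 ?(ltW Kc0)// andbT.
    by rewrite leeBlDr// -EFinD addrC.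
  apply: (le_trans (leeD2r _ hex)).
  by rewrite -EFinD -EFinM lee_fin; lra.
have mex : measurable_fun [set: T] (fun w => excess (y, w)).
  by apply: (measurableT_comp measurable_excess); exact: measurable_pair1.
have le1 : (\int[P]_w excess (y, w) + Kc%:E <= Kc%:E * (1 + 3 * (x / y))%:E)%E.
  apply: (@le_trans _ _ (\int[P]_w (excess (y, w) + Kc%:E))%E).
    rewrite ge0_integralD//; last 2 first.
    - by move=> w _; exact: excess_ge0.
    - by move=> w _; rewrite lee_fin ltW.
    by rewrite integral_cst//= probability_setT mule1.
  apply: (@le_trans _ _ (\int[P]_w (Kc%:E * Psi w))%E).
    apply: ge0_le_integral => //.
    - by move=> w _; rewrite adde_ge0 ?excess_ge0// lee_fin ltW.
    - by apply: emeasurable_funD.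
    - by apply: emeasurable_funM.
  rewrite ge0_integralZl_EFin ?(ltW Kc0)//.
  by rewrite lee_wpmul2l// lee_fin ltW.
have -> : (3 * x / moment_rate * expR (- (moment_rate * (b y / y))))%R = Kc * (3 * (x / y)).
  rewrite /Kc (_ : moment_rate * (b y / y) = a * b y); last by rewrite /a; ring.
  by rewrite /a; field; rewrite !gt_eqF.
move: le1; rewrite -EFinM mulrDr mulr1 EFinD addeC.
by rewrite leeD2lE.
Qed.

Lemma lifetime_tail t K S : 0 < t -> 0 <= K ->
  (\int[m]_(y in [set y : R | (0 < y)%R]) (b y)%:E <= (t / 2)%:E)%E ->
  (forall y, 0 < y -> expR (- (moment_rate * (b y / y))) <= K * y) ->
  (\int[m]_(y in [set y : R | (0 < y)%R]) y%:E = S%:E)%E ->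
  (P [set w | (t%:E < lifetime W L m x w)%E] <= (2 / t * (3 / moment_rate * K * S) * x)%:E)%E.
Proof.
move=> t0 K0 hb hK hS; have k0 := moment_rate_gt0.
have t20 : 0 < t / 2 by rewrite divr_gt0.
have mpos : measurable [set y : R | 0 < y].
  have -> : [set y : R | 0 < y] = `]0, +oo[%classic.
    by apply/seteqP; split => y /=; rewrite in_itv/= andbT.
  exact: measurable_itv.
pose F w := (\int[m]_y excess (y, w))%E.
have mF : measurable_fun [set: T] F.
  by apply: (measurable_integral_speed hm); [exact: measurable_excess|exact: excess_ge0].
have F0 w : (0 <= F w)%E by apply: integral_ge0 => y _; exact: excess_ge0.
have meanF : (\int[P]_w F w <= (3 / moment_rate * K * S * x)%:E)%E.
  rewrite /F (tonelli_speed hm P measurable_excess excess_ge0).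
  pose c := 3 * x / moment_rate * K.
  have c0 : 0 <= c by rewrite mulr_ge0// divr_ge0 ?(ltW k0)// mulr_ge0// ltW.
  apply: (@le_trans _ _ (\int[m]_(y in [set y : R | (0 < y)%R]) (c%:E * y%:E))%E); last first.
    rewrite ge0_integralZl_EFin//; last by move=> y /= y0; rewrite lee_fin ltW.
    by rewrite hS -EFinM lee_fin /c le_eqVlt; apply/orP; left; apply/eqP; ring.
  rewrite [leRHS]integral_mkcond; apply: ge0_le_integral => //.
  - by move=> y _; apply: integral_ge0 => w _; exact: excess_ge0.
  - have h := @measurable_fun_fubini_tonelli_F _ _ R T R P excess measurable_excess excess_ge0.
    exact h.
  - apply/(measurable_restrictT _ mpos); exact: emeasurable_funM.
  - move=> y _; rewrite patchE; case: (boolP (y \in _)) => [|/negP]; rewrite inE/= => y0.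
      apply: (le_trans (excess_expectation y0)).
      rewrite -EFinM lee_fin /c -[leRHS]mulrA; apply: ler_wpM2l; last exact: hK.
      by rewrite divr_ge0 ?(ltW k0)// mulr_ge0// ltW.
    move: y0 => /negP; rewrite -leNgt => y0.
    rewrite integral0_eq// => w _; rewrite /excess peak_le0// add0e.
    by apply: max_idPr; rewrite -EFinN lee_fin oppr_le0.
have hF w : (t%:E < lifetime W L m x w)%E -> ((t / 2)%:E <= F w)%E.
  move=> tl; have : (t%:E <= (t / 2)%:E + F w)%E.
    apply: (le_trans (ltW tl)); apply: (le_trans (lifetime_le_peak w)).
    apply: le_trans (leeD2r _ hb).
    rewrite [X in (_ <= X + _)%E]integral_mkcond -ge0_integralD//; last 4 first.
    - by move=> y _; rewrite patchE; case: ifP => // _; rewrite lee_fin.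
    - apply/(measurable_restrictT _ mpos); apply/measurable_EFinP; exact: measurable_funTS.
    - by move=> y _; exact: excess_ge0.
    - by apply: (measurableT_comp measurable_excess); exact: measurable_pair2.
    apply: ge0_le_integral => //.
    - by move=> y _; exact: peak_ge0.
    - by apply: (measurableT_comp measurable_peak); exact: measurable_pair2.
    - apply: emeasurable_funD.
        apply/(measurable_restrictT _ mpos); apply/measurable_EFinP; exact: measurable_funTS.
      by apply: (measurableT_comp measurable_excess); exact: measurable_pair2.
    - move=> y _; rewrite patchE; case: (boolP (y \in _)) => [_|/negP]; last first.
        rewrite inE/= => /negP; rewrite -leNgt => y0; rewrite peak_le0// add0e; exact: excess_ge0.
      by rewrite -leeBlDl// /excess le_max lexx.
  by rewrite -leeBlDl// -EFinB (_ : t - t / 2 = t / 2)//; field.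
pose A := [set w | (t%:E < lifetime W L m x w)%E].
have mA : measurable A.
  have ml := measurable_lifetime mW W0 cW hL hm x0.
  by rewrite -[A]setTI; apply: emeasurable_fun_o_infty.
have : ((t / 2)%:E * P A <= (3 / moment_rate * K * S * x)%:E)%E.
  apply: le_trans meanF; rewrite -integral_cst//.
  apply: (@le_trans _ _ (\int[P]_(w in A) F w)%E).
    apply: ge0_le_integral => //.
    - by move=> w _; rewrite lee_fin ltW.
    - exact: measurable_funTS.
  exact: ge0_subset_integral.
rewrite -lee_pdivlMl//; move/le_trans; apply.
by rewrite -EFinM lee_fin le_eqVlt; apply/orP; left; apply/eqP; field; rewrite !gt_eqF.
Qed.

(** At time i the path is at or below 0, so A has reached the lifetime; it exceeds it strictly by
    time j, because it increases on a final stretch before j where the path is positive. *)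
Lemma absorption_le_of_oscillation t w i j : (i < j)%N ->
  W i%:R w <= - x -> - x < W j%:R w ->
  (lifetime W L m x w <= t%:E)%E -> (absorption_time W L m x w <= t%:E)%E.
Proof.
clear mb b0; move=> ij wi wj le.
have xi : x + W i%:R w <= 0 by lra.
have le_i : (lifetime W L m x w <= add_fun W L m x i%:R w)%E.
  exact: (lifetime_le_add_fun m (@cW w) (@l0 w) (@lc w) (@occupation w)).
apply/(absorption_time_leP x0 (W0 w) (@cW w) (@l0 w) (@lc w) (@occupation w) hm); split => //; first by exists i%:R.
exists j%:R => //.
have wj0 : 0 < x + W j%:R w by lra.
have [del del0 h] := path_continuous_dist (@cW w) (ler0n R j) wj0.
have ijR : i%:R < j%:R :> R by rewrite ltr_nat.
pose s := Num.max i%:R (j%:R - del / 2).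
have is_ : i%:R <= s by rewrite le_max lexx.
have sj : s < j%:R by rewrite gt_max ijR/=; lra.
have sd : j%:R - del / 2 <= s by rewrite le_max lexx orbT.
have s0 : 0 <= s by apply: le_trans is_.
have pos_on u : s <= u <= j%:R -> 0 < x + W u w.
  move=> /andP[su uj]; have u0 : 0 <= u by exact: le_trans su.
  have /(h _ u0) : `|j%:R - u| < del by rewrite ger0_norm ?subr_ge0//; lra.
  by rewrite ltr_norml => /andP[? ?]; lra.
have mono u v : 0 <= u -> u <= v -> (add_fun W L m x u w <= add_fun W L m x v w)%E.
  by move=> u0 uv; apply: add_fun_nondecreasing => //; exact: (@occupation w).
have [fin|] := ltP (add_fun W L m x s w) +oo%E.
  apply: (le_lt_trans le_i); apply: le_lt_trans (mono _ _ (ler0n _ _) is_) _.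
  by apply: add_fun_increases => //; exact: (@occupation w).
(* If A is already infinite at s, it exceeds the finite lifetime at j. *)
move=> /(le_trans)/(_ (mono _ _ s0 (ltW sj))) inf.
apply: lt_le_trans inf.
by apply: le_lt_trans le _; rewrite ltry.
Qed.

End Excess.

(** * Conclusion: the tail bound up to a null set *)

Unset Implicit Arguments.

Theorem mainTheorem7 (R : realType) (d : measure_display) (T : measurableType d)
  (P : probability T R) (W : R -> T -> R) (L : R -> R -> T -> R)
  (m : {measure set R -> \bar R}) (C rho : R) :
  std_brownian P W ->
  local_time W L ->
  speed_measure m ->
  (\int[m]_(y in [set y : R | (1 <= y)%R]) y%:E < +oo)%E ->
  (\int[m]_(y in [set y : R | (0 < y <= 1)%R]) y%:E < +oo)%E ->
  0 < C -> 0 < rho ->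
  (forall x, 0 < x < 1 -> (\int[m]_(y in [set y : R | (0 < y <= x)%R]) y%:E <= (C * x `^ rho)%:E)%E) ->
  forall t : R, 0 < t ->
  exists At : R, forall x : R, 0 < x ->
    (P [set w | (t%:E < absorption_time W L m x w)%E] <= (At * x)%:E)%E.
Proof.
move=> hW hL hm int_infty int_zero C0 rho0 int_rho t t0.
have k0 := @moment_rate_gt0 R.
have t20 : 0 < t / 2 by rewrite divr_gt0.
have [b [mb b0 hb [K K0 hK]]] := threshold int_zero C0 rho0 int_rho k0 t20.
have Sfin := integral_id_finite int_infty int_zero.
have S0 : (0 <= \int[m]_(y in [set y : R | (0 < y)%R]) y%:E)%E.
  by apply: integral_ge0 => y /= y0; rewrite lee_fin ltW.
have [S hS] : exists S, (\int[m]_(y in [set y : R | (0 < y)%R]) y%:E = S%:E)%E.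
  by move: Sfin S0; case: (integral _ _ _) => // S; exists S.
(* K and S come from m, C, rho and t before x is introduced, so the constant is uniform in x. *)
exists (2 / t * (3 / moment_rate * K * S)) => x x0.
apply: le_trans (lifetime_tail hW hL hm x0 mb b0 t0 K0 hb hK hS).
have [mW W0 cW _] := hW.
have [N [mN N0 hN]] := brownian_oscillates hW x0.
have mA := measurable_absorption_time mW W0 cW hL hm x0 t.
have ml : measurable [set w | (t%:E < lifetime W L m x w)%E].
  have ml := measurable_lifetime mW W0 cW hL hm x0.
  by rewrite -[X in measurable X]setTI; apply: emeasurable_fun_o_infty.
(* Outside N, a lifetime at most t forces absorption by t. *)
apply: (@le_trans _ _ (P ([set w | (t%:E < lifetime W L m x w)%E] `|` N))).
  apply: le_measure; rewrite ?inE//; first exact: measurableU.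
  move=> w /= tw; have [wN|wN] := pselect (N w); first by right.
  left; rewrite ltNge; apply/negP => le.
  have [i [j [ij wi wj]]] := hN w wN.
  have := absorption_le_of_oscillation hW hL hm x0 ij wi wj le.
  by rewrite leNgt tw.
apply: le_trans (measureU2 _ ml mN) _.
by rewrite -[leRHS]adde0; apply: leeD => //; have /eqP := N0; rewrite eq_le => /andP[].
Qed.
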